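(* Let $T$ be a power bounded operator acting on a complex Hilbert space $H$ with $\sigma_p(T)\cap\mathbb{T}=\emptyset$, let $g\in M_l$ for some $l\in\mathbb{N}\cup\{0\}$, and let $f\in P_m$ for some $m\in\mathbb{N}$. Then for every $x\in H$ $$ \lim_{N\to\infty}\frac{1}{N}\sum_{n=1}^N e^{2\pi i g(n)}T^{[f(n)]}x=0 $$ in the norm of $H$; that is, these averages converge to $0$ in the strong operator topology.
   Context: $\mathbb{T}$ is the unit circle in $\mathbb{C}$, $\sigma_p(T)$ is the set of eigenvalues of $T$, $T$ is power bounded if $\sup_{n\ge0}\|T^n\|<\infty$, and $[\cdot]$ is the integer part. Convention: $T^{[f(n)]}=I$ if the exponent is negative or $f(n)$ is not defined; the finitely many $n$ for which $g(n)$ is not defined are irrelevant (put, e.g., the corresponding weight equal to $1$). Let $B$ be the ring of germs at $+\infty$ of continuous real functions of a real variable (functions defined on some $[t_0,\infty)$, identified if equal for all large $t$). A Hardy field is a subfield of $B$ closed under differentiation. $U$ is the union of all Hardy fields and $U_+$ is the set of $f\in U$ with $f(t)>0$ for all large $t$. For eventually positive $f,g$, write $f\prec g$ if $\lim_{t\to\infty}f(t)/g(t)=0$. For $l\in\mathbb{N}\cup\{0\}$, $M_l=\{g\in U_+: t^l\ln t\prec g\prec t^{l+1}\}$. Class $P_m$ ($m\in\mathbb{N}$, $m\ge1$): $f\in B$ is of class $P_m$ if, for all $t$ large enough, $f$ has continuous derivatives $f',\dots,f^{(m)}$ with $f,f',\dots,f^{(m)}>0$, and $$\limsup_{t\to\infty}\frac{f^{(m-1)}(t)}{t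 f^{(m)}(t)}<\infty,\qquad \limsup_{t\to\infty}\sup\Bigl\{\frac{f^{(m)}(s)}{f^{(m)}(t)}: s\ge t\Bigr\}<\infty.$$ *)

(* Defs.v *)
From HB Require Import structures.
From mathcomp Require Import all_boot all_order all_algebra.
From mathcomp Require Import all_classical all_reals all_analysis.
From mathcomp Require Import complex.

Set Implicit Arguments.
Unset Strict Implicit.
Unset Printing Implicit Defensive.

Import Order.TTheory GRing.Theory Num.Theory.
Import numFieldNormedType.Exports.

Local Open Scope ring_scope.
Local Open Scope classical_set_scope.

Section Germs.
Variable R : realType.
Implicit Types (f g : R -> R) (K : set (R -> R)).

(* A germ at +oo is handled through its representatives [f : R -> R], whose
   values on any bounded-above set are irrelevant; a set of germs is a set of
   functions that is saturated for [germ_eq]. *)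
Definition germ_eq f g : Prop := \forall t \near +oo, f t = g t.

(* the ring B *)
Definition cont_germ : set (R -> R) :=
  [set f | \forall t \near +oo, {for t, continuous f}].

Record hardy_field K : Prop := HardyField {
  hardy_saturated : forall f g, germ_eq f g -> K f -> K g;
  hardy_cont : K `<=` cont_germ;
  hardy1 : K (cst 1);
  hardyB : forall f g, K f -> K g -> K (f \- g);
  hardyM : forall f g, K f -> K g -> K (f \* g);
  hardyV : forall f, K f -> ~ germ_eq f (cst 0) ->
    exists2 g, K g & germ_eq (f \* g) (cst 1);
  hardy_deriv : forall f, K f ->
    (\forall t \near +oo, derivable f t 1) /\ K f^`() }.

Definition hardy_union : set (R -> R) :=
  [set f | exists2 K, hardy_field K & K f].

Definition hardy_pos : set (R -> R) :=
  [set f | hardy_union f /\ \forall t \near +oo, 0 < f t].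

Definition prec f g : Prop := f t / g t @[t --> +oo] --> (0 : R).

Definition classM (l : nat) : set (R -> R) :=
  [set g | [/\ hardy_pos g,
               prec (fun t => t ^+ l * ln t) g &
               prec g (fun t => t ^+ l.+1)] ].

Definition classP (m : nat) : set (R -> R) :=
  [set f | [/\ cont_germ f,
      (\forall t \near +oo,
         (forall k, (k < m)%N -> derivable (derive1n k f) t 1) /\
         (forall k, (k <= m)%N -> {for t, continuous (derive1n k f)} /\ 0 < derive1n k f t)),
      (limf_esup (fun t => (derive1n m.-1 f t / (t * derive1n m f t))%:E) +oo%R < +oo)%E &
      (limf_esup (fun t => ereal_sup
         [set (derive1n m f s / derive1n m f t)%:E | s in `[t, +oo[ ]) +oo%R < +oo)%E] ].

(* e^{2 pi i x} *)
Definition e2pi (x : R) : R[i] := Complex (cos (2 * pi * x)) (sin (2 * pi * x)).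

End Germs.

Section Operators.
Variables (R : realType) (H : normedModType R[i]).
Implicit Type T : H -> H.

(* [`|T x|] lives in [R[i]] and is real; [complex.Re] brings it back to [R]. *)
Definition opnorm T : \bar R :=
  ereal_sup [set (complex.Re `|T x|)%:E | x in [set x : H | `|x| <= 1] ].

Definition power_bounded T : Prop :=
  (ereal_sup [set opnorm (iter n T) | n in [set: nat] ] < +oo)%E.

Definition point_spectrum T : set R[i] :=
  [set lambda | exists2 x : H, x != 0 & T x = lambda *: x].

Definition unit_circle : set R[i] := [set z | `|z| = 1].

(* T^k, with the convention T^k = I for k < 0 *)
Definition oppow T (k : int) : H -> H :=
  match k with Posz n => iter n T | Negz _ => id end.

End Operators.
Arguments unit_circle : clear implicits.

(* Main.v *)
(* The weights e^{2 pi i g(n)} only matter through their modulus: the averages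
   of c_n T^[f(n)] x tend to 0 uniformly over all weights |c_n| <= 1.

   For the sequence a_n = n, the mean ergodic theorem applied to the operators
   z T, |z| = 1, which have no fixed vectors, and compactness of the circle make
   the averages of z^n T^n x uniformly small in z. A Wiener type argument then
   makes the correlations phi(d), the averages of <T^{i+d} x, T^i x> over i < J,
   small for most d, and van der Corput's inequality concludes. T is not
   isometric, but |T^k u| <= A |T^i u| for i <= k, so |T^k u|^2 may be replaced
   by the average of A^2 |T^i u|^2 over i < J, a form for which T is almost
   isometric as soon as J is large.

   The same inequality reduces a slowly varying sequence a_n to its differences
   a_{n+h} - a_n. If f is of class P_{m+1} then f(t + h) - f(t) is of class P_m,
   and the errors 0 or 1 coming from the integer parts are absorbed by the
   weights. In class P_1, f takes each integer part about equally often, which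
   leads back to a_n = n. *)
Require Import Defs.
From HB Require Import structures.
From mathcomp Require Import all_boot all_order all_algebra.
From mathcomp Require Import all_classical all_reals all_analysis.
From mathcomp Require Import complex.
From mathcomp Require Import ring lra zify.

Set Implicit Arguments.
Unset Strict Implicit.
Unset Printing Implicit Defensive.

Import Order.TTheory GRing.Theory Num.Theory.
Import numFieldNormedType.Exports.

Local Open Scope ring_scope.
Local Open Scope classical_set_scope.

(** A power bounded operator need not be similar to a contraction, so no unitary dilation or
    spectral measure of [x] is available. Only finite sums are used: orthogonality of roots of unity
    stands in for Fourier analysis on the circle, and the averaging length J is tied to the
    sequence. Lowering all exponents of a window by up to J needs J <= a_n, while the defect of
    invariance costs (spread of the window) / J. So the increments of a_n must be small compared
    with a_n itself, and an initial segment, a small proportion of the N terms, has to be discarded.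

    The hypothesis on eigenvalues enters only for a_n = n. The induction propagates because
    smallness is asserted of the vector sum, uniformly in the weights: Cauchy-Schwarz converts it
    into smallness of weighted correlations whatever J is, and the products c_{i+j} c_{i+k}^* are
    again admissible weights. One constant A >= 1 bounds both the powers of T and the orbit of x,
    which is why the powers of A below are not homogeneous in x. *)

Section RealNorms.
Variable R : realType.
Local Notation C := R[i].
Implicit Types (z w : C) (a b r : R).

(* [rc], [cre], [cm] fix the [realType] instance on [R], whereas the
   operations of [complex] come with its [rcfType] instance, on which
   [ring] and [lra] get stuck. *)
Definition rc (r : R) : C := real_complex R r.
Definition cre (z : C) : R := complex.Re z.
Definition cm (z : C) : R := complex.Re `|z|.

Lemma rcK r : cre (rc r) = r. Proof. by []. Qed.

Lemma rcM a b : rc (a * b) = rc a * rc b. Proof. exact: rmorphM. Qed.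

Lemma rcD a b : rc (a + b) = rc a + rc b. Proof. exact: rmorphD. Qed.

Lemma rcX a n : rc (a ^+ n) = rc a ^+ n. Proof. exact: rmorphXn. Qed.

Lemma rcV a : rc a^-1 = (rc a)^-1. Proof. exact: fmorphV. Qed.

Lemma rc_nat n : rc n%:R = n%:R. Proof. exact: rmorph_nat. Qed.

Lemma rc_sum (I : Type) (s : seq I) (P : pred I) (F : I -> R) :
  rc (\sum_(i <- s | P i) F i) = \sum_(i <- s | P i) rc (F i).
Proof. exact: rmorph_sum. Qed.

Lemma rc_inj : injective rc. Proof. exact: complexI. Qed.

Lemma rc_le a b : (rc a <= rc b) = (a <= b). Proof. exact: lecR. Qed.

Lemma rc_lt a b : (rc a < rc b) = (a < b). Proof. exact: ltcR. Qed.

Lemma conj_rc r : (rc r)^* = rc r.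
Proof. by apply/eqP; rewrite eq_complex /= oppr0 !eqxx. Qed.

Lemma cjM z w : (z * w)^* = z^* * w^*. Proof. exact: rmorphM. Qed.

Lemma cj_sum (I : Type) (s : seq I) (P : pred I) (F : I -> C) :
  (\sum_(i <- s | P i) F i)^* = \sum_(i <- s | P i) (F i)^*.
Proof. exact: rmorph_sum. Qed.

Lemma rc_ge0E z : 0 <= z -> z = rc (cre z).
Proof. by case: z => a b; rewrite lecE /= => /andP[/eqP -> _]. Qed.

Lemma creD z w : cre (z + w) = cre z + cre w. Proof. by case: z; case: w. Qed.

Lemma creN z : cre (- z) = - cre z. Proof. by case: z. Qed.

Lemma creJ z : cre (z^*) = cre z. Proof. by case: z. Qed.

Lemma cmE z : `|z| = rc (cm z).
Proof. by rewrite /cm normc_def. Qed.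

Lemma cm_ge0 z : 0 <= cm z.
Proof. by have := normr_ge0 z; rewrite cmE -(rmorph0 (real_complex R)) rc_le. Qed.

Lemma cmM z w : cm (z * w) = cm z * cm w.
Proof. by apply: rc_inj; rewrite -cmE normrM !cmE -rcM. Qed.

Lemma cmD z w : cm (z + w) <= cm z + cm w.
Proof. by rewrite -rc_le -cmE rcD -!cmE ler_normD. Qed.

Lemma cm0 : cm 0 = 0.
Proof. by rewrite /cm normr0. Qed.

Lemma cmN z : cm (- z) = cm z.
Proof. by rewrite /cm normrN. Qed.

Lemma cmJ z : cm (z^*) = cm z.
Proof. by rewrite /cm norm_conjC. Qed.

Lemma cm_sum (I : Type) (s : seq I) (P : pred I) (F : I -> C) :
  cm (\sum_(i <- s | P i) F i) <= \sum_(i <- s | P i) cm (F i).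
Proof.
elim/big_rec2: _ => [|i y z _ h]; first by rewrite cm0.
exact: le_trans (cmD _ _) (lerD (lexx _) h).
Qed.

Lemma cm_rc r : cm (rc r) = `|r|.
Proof. by rewrite /cm normc_def /= expr0n addr0 sqrtr_sqr. Qed.

Lemma cm_nat n : cm n%:R = n%:R.
Proof. by rewrite -rc_nat cm_rc ger0_norm. Qed.

Lemma cmX z n : cm (z ^+ n) = cm z ^+ n.
Proof. by apply: rc_inj; rewrite -cmE normrX !cmE -rcX. Qed.

Lemma cmV z : cm z^-1 = (cm z)^-1.
Proof. by apply: rc_inj; rewrite -cmE normfV !cmE -rcV. Qed.

Lemma mulJ_cm z : z * z^* = rc (cm z ^+ 2).
Proof. by rewrite -normCK cmE rcX. Qed.

Lemma cre_le_cm z : cre z <= cm z.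
Proof.
have := normc_ge_Re z; rewrite cmE rc_le.
exact: le_trans (ler_norm _).
Qed.

End RealNorms.

(** * Real-valued norm and the Cauchy-Schwarz inequality *)

Section Hilbert.
Variables (R : realType) (H : normedModType R[i]).
Local Notation C := R[i].

Definition nm (x : H) : R := complex.Re `|x|.

Lemma nmE x : `|x| = rc (nm x).
Proof. exact: rc_ge0E (normr_ge0 x). Qed.

Lemma nm_ge0 x : 0 <= nm x.
Proof. by have := normr_ge0 x; rewrite nmE -(rmorph0 (real_complex R)) rc_le. Qed.

Lemma nmZ (z : C) x : nm (z *: x) = cm z * nm x.
Proof. by apply: rc_inj; rewrite -nmE normrZ nmE cmE -rcM. Qed.

Lemma nmD x y : nm (x + y) <= nm x + nm y.
Proof. by rewrite -rc_le -nmE rcD -!nmE ler_normD. Qed.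

Lemma nmN x : nm (- x) = nm x.
Proof. by rewrite /nm normrN. Qed.

Lemma nmB x y : nm (x - y) <= nm x + nm y.
Proof. by rewrite (le_trans (nmD _ _)) // nmN. Qed.

Lemma nm0 : nm 0 = 0.
Proof. by rewrite /nm normr0. Qed.

Lemma nm_eq0 x : nm x = 0 -> x = 0.
Proof. by move=> x0; apply/eqP; rewrite -normr_eq0 nmE x0. Qed.

Lemma nm_sum (I : Type) (s : seq I) (P : pred I) (F : I -> H) :
  nm (\sum_(i <- s | P i) F i) <= \sum_(i <- s | P i) nm (F i).
Proof.
elim/big_rec2: _ => [|i y z _ h]; first by rewrite nm0.
exact: le_trans (nmD _ _) (lerD (lexx _) h).
Qed.

Lemma nm_sum_le (n : nat) (F : nat -> H) (A : R) :
  (forall i, (i < n)%N -> nm (F i) <= A) ->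
  nm (\sum_(i < n) F i) <= n%:R * A.
Proof.
move=> h; apply: le_trans (nm_sum _ _ _) _.
rewrite mulr_natl -[X in _ *+ X]card_ord -sumr_const.
by apply: ler_sum => i _; apply: h.
Qed.

Variable ip : {dot H for Num.conj}.
Hypothesis ip_norm : forall x : H, ip x x = `|x| ^+ 2.

Lemma ip_nm x : ip x x = rc (nm x ^+ 2).
Proof. by rewrite ip_norm nmE -rcX. Qed.

Lemma ipJ x y : ip y x = (ip x y)^*.
Proof. by rewrite hermC /= expr0 mul1r. Qed.

Lemma ip_suml (I : Type) (s : seq I) (P : pred I) (F : I -> H) y :
  ip (\sum_(i <- s | P i) F i) y = \sum_(i <- s | P i) ip (F i) y.
Proof. exact: linear_sumlz. Qed.

Lemma ip_sumr (I : Type) (s : seq I) (P : pred I) (F : I -> H) y :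
  ip y (\sum_(i <- s | P i) F i) = \sum_(i <- s | P i) ip y (F i).
Proof. exact: linear_sumr. Qed.

Lemma ipZl (a : C) x y : ip (a *: x) y = a * ip x y.
Proof. by rewrite linearZl_LR. Qed.

Lemma ipZr (a : C) x y : ip x (a *: y) = a^* * ip x y.
Proof. by rewrite linearZr_LR. Qed.

Lemma nmB_sqr x y :
  nm (x - y) ^+ 2 = nm x ^+ 2 + nm y ^+ 2 - 2 * cre (ip x y).
Proof.
have := ip_nm (x - y); rewrite dnormB !ip_nm -/(ip x y).
move=> /(congr1 (@cre R)); rewrite !(creD, creN, rcK) creJ => <-; ring.
Qed.

Lemma nmD_sqr x y :
  nm (x + y) ^+ 2 = nm x ^+ 2 + nm y ^+ 2 + 2 * cre (ip x y).
Proof.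
have := nmB_sqr x (- y); rewrite opprK nmN linearNr creN => ->; ring.
Qed.

Lemma parallelogram x y :
  nm (x - y) ^+ 2 + nm (x + y) ^+ 2 = 2 * (nm x ^+ 2 + nm y ^+ 2).
Proof. by rewrite nmB_sqr nmD_sqr; ring. Qed.

Lemma ip_CS x y : cm (ip x y) <= nm x * nm y.
Proof.
have [->|y0] := eqVneq y 0.
  by rewrite linear0r cm0 mulr_ge0 ?nm_ge0.
have ny : 0 < nm y.
  rewrite lt_neqAle nm_ge0 andbT eq_sym; apply: contra y0 => /eqP h.
  by apply/eqP/nm_eq0.
set a := ip x y.
(* The vector is [x] minus its orthogonal projection on [y]. *)
have := sqr_ge0 (nm (x - (rc (nm y ^+ 2)^-1 * a) *: y)).
rewrite nmB_sqr nmZ ipZr cmM cm_rc -/a.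
have -> : (rc (nm y ^+ 2)^-1 * a)^* * a = rc ((nm y ^+ 2)^-1 * cm a ^+ 2).
  by rewrite cjM -mulrA [_^* * a]mulrC mulJ_cm conj_rc -rcM.
rewrite rcK ger0_norm ?invr_ge0 ?sqr_ge0 // => h.
have ny2 : 0 < nm y ^+ 2 by apply: exprn_gt0.
rewrite -(@ler_pXn2r _ 2) ?nnegrE ?mulr_ge0 ?nm_ge0 ?cm_ge0 //.
rewrite exprMn -ler_pdivrMr //.
have e : ((nm y ^+ 2)^-1 * cm a * nm y) ^+ 2 = cm a ^+ 2 / nm y ^+ 2.
  by field; rewrite gt_eqF.
rewrite e in h; nra.
Qed.

End Hilbert.

Section IterLinear.
Variables (R : realType) (H : normedModType R[i]) (S : {linear H -> H}).

Lemma iterlinD n x y : iter n S (x + y) = iter n S x + iter n S y.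
Proof. by elim: n => //= n ->; rewrite linearD. Qed.

Lemma iterlinZ n (a : R[i]) x : iter n S (a *: x) = a *: iter n S x.
Proof. by elim: n => //= n ->; rewrite linearZ. Qed.

Lemma iterlinN n x : iter n S (- x) = - iter n S x.
Proof. by elim: n => //= n ->; rewrite linearN. Qed.

Lemma iterlin_sum n (I : Type) (s : seq I) (P : pred I) (F : I -> H) :
  iter n S (\sum_(i <- s | P i) F i) = \sum_(i <- s | P i) iter n S (F i).
Proof. by elim: n => //= n ->; rewrite linear_sum. Qed.

Lemma coboundary_sum N y :
  \sum_(k < N) iter k S (y - S y) = y - iter N S y.
Proof.
elim: N => [|N IH]; first by rewrite big_ord0 subrr.
by rewrite big_ord_recr /= IH iterlinD iterlinN -iterSr addrA subrK.
Qed.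

End IterLinear.

(** * Mean ergodic theorem for power bounded operators without fixed vectors *)

Section MeanErgodic.
Variables (R : realType) (H : completeNormedModType R[i]).

Lemma nm_complete (w : nat -> H) :
  (forall e : R, 0 < e -> exists n, forall m, (n <= m)%N -> nm (w n - w m) < e) ->
  exists z, forall e : R, 0 < e ->
    exists n, forall m, (n <= m)%N -> nm (z - w m) < e.
Proof.
move=> wC; have : cvg (w @ \oo).
  apply/cauchy_cvgP/cauchy_exP => e e0.
  have e0' : 0 < cre e by rewrite -rc_lt -rc_ge0E // ltW.
  have [n wn] := wC _ e0'; exists (w n); exists n => // m /= nm_.
  by rewrite -ball_normE /= nmE (rc_ge0E (ltW e0)) rc_lt wn.
move=> /cvgrPdist_lt wz; exists (lim (w @ \oo)) => e e0.
have e0' : (0 : R[i]) < rc e by rewrite -(rmorph0 (real_complex R)) rc_lt.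
have [n _ nP] := wz _ e0'; exists n => m nm_.
by have := nP m nm_; rewrite /= nmE rc_lt.
Qed.

Variable ip : {dot H for Num.conj}.
Hypothesis ip_norm : forall x : H, ip x x = `|x| ^+ 2.

Lemma half_nm (x : H) : nm (2^-1 *: x) ^+ 2 = nm x ^+ 2 / 4.
Proof. by rewrite nmZ cmV cm_nat; field. Qed.

Lemma natV_small (e : R) : 0 < e -> exists n, (n.+1%:R)^-1 < e :> R.
Proof.
move=> e0; exists (Num.truncn e^-1).
rewrite invf_plt ?posrE // ?ltr0n //.
by have := truncnS_gt e^-1.
Qed.

Lemma ler_natV (m n : nat) : (m <= n)%N -> (n.+1%:R)^-1 <= (m.+1%:R)^-1 :> R.
Proof. by move=> mn; rewrite lef_pV2 ?posrE ?ltr0n // ler_nat ltnS. Qed.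

Variables (S : {linear H -> H}) (M : R).
Hypothesis M0 : 0 <= M.
Hypothesis S_pb : forall n y, nm (iter n S y) <= M * nm y.

(** Cesaro means of the orbit of [x] do it: such a mean differs from [x] by a coboundary, has norm
    at most [M * nm x], and [1 - S] maps it to [(x - S^N x) / N]. *)
Lemma almost_fixed x n : exists y,
  nm ((x - (y - S y)) - S (x - (y - S y))) <= (n.+1%:R)^-1 /\
  nm (x - (y - S y)) <= M * nm x.
Proof.
pose Y k := \sum_(j < k) iter j S x.
have YE k : Y k - S (Y k) = x - iter k S x.
  by rewrite linear_sum -sumrB -(coboundary_sum S); apply: eq_bigr => j _;
     rewrite iterlinD iterlinN -iterSr.
(* The summand 1 keeps the bound invertible when [x = 0]. *)
have [|N NP] := @natV_small (((1 + M) * nm x + 1)^-1 / n.+1%:R).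
  by rewrite mulr_gt0 ?invr_gt0 ?ltr0n // ltr_wpDl // mulr_ge0 ?nm_ge0 ?addr_ge0.
pose y := (N.+1%:R : R[i])^-1 *: \sum_(k < N.+1) Y k.
exists y.
have N0 : (N.+1%:R : R[i]) != 0 by rewrite pnatr_eq0.
have yE : x - (y - S y) = (N.+1%:R : R[i])^-1 *: \sum_(k < N.+1) iter k S x.
  rewrite /y linearZ /= -scalerBr (linear_sum S) -sumrB.
  under [X in _ *: X]eq_bigr do rewrite YE.
  rewrite sumrB scalerBr sumr_const card_ord -[x *+ _]scaler_nat scalerA mulVf //.
  by rewrite scale1r opprB addrC subrK.
rewrite yE; split; last first.
  rewrite nmZ cmV cm_nat ler_pdivrMl ?ltr0n //.
  by apply: (@nm_sum_le _ _ _ (fun k => iter k S x)) => k _; apply: S_pb.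
rewrite linearZ /= -scalerBr (linear_sum S) -sumrB.
have -> : \sum_(k < N.+1) (iter k S x - S (iter k S x)) = x - iter N.+1 S x.
  by rewrite -(coboundary_sum S); apply: eq_bigr => k _; rewrite iterlinD iterlinN -iterSr.
rewrite nmZ cmV cm_nat.
have : nm (x - iter N.+1 S x) <= (1 + M) * nm x + 1.
  apply: le_trans (nmB _ _) _; have := S_pb N.+1 x; have := nm_ge0 x; nra.
set u := nm (_ - _); set v := _ + 1 => uv.
have v0 : 0 < v by rewrite ltr_wpDl // mulr_ge0 ?nm_ge0 ?addr_ge0.
have n0 : (0 : R) < n.+1%:R by rewrite ltr0n.
apply: (@le_trans _ _ (N.+1%:R^-1 * v)).
  by rewrite ler_pM2l // invr_gt0 ltr0n.
by rewrite -ler_pdivlMr //; apply: ltW; rewrite mulrC.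
Qed.

(* The vectors [w] of [x + range (S - 1)] with [|w - S w| <= 1/(n+1)] form
   decreasing convex sets; by the parallelogram law their almost minimal
   vectors converge, necessarily to a fixed vector. *)
Lemma coboundary_dense : (forall z, S z = z -> z = 0) ->
  forall x (e : R), 0 < e -> exists y, nm (x - (y - S y)) <= e.
Proof.
move=> nofix x e e0.
pose K n : set H := [set w | (exists y, w = x - (y - S y)) /\
                     nm (w - S w) <= (n.+1%:R)^-1].
have Kmono m n w : (m <= n)%N -> K n w -> K m w.
  by move=> mn [? wn]; split => //; apply: le_trans wn (ler_natV mn).
have Kmid n w w' : K n w -> K n w' -> K n (2^-1 *: (w + w')).
  move=> [[y ->] wn] [[y' ->] wn']; split.
    exists (2^-1 *: (y + y')).
    have -> : S (2^-1 *: (y + y')) = 2^-1 *: (S y + S y').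
      by rewrite linearZ linearD.
    rewrite -scalerBr [- (S y + S y')]opprD [y + y' + _]addrACA.
    rewrite [x - _ + _]addrACA -[- (y - S y) - _]opprD [LHS]scalerBr; congr (_ - _).
    by rewrite scalerDr -scalerDl (_ : 2^-1 + 2^-1 = 1) ?scale1r //; field.
  set u := x - (y - S y) in wn *; set u' := x - (y' - S y') in wn' *.
  have -> : S (2^-1 *: (u + u')) = 2^-1 *: (S u + S u').
    by rewrite linearZ linearD.
  rewrite -scalerBr opprD addrACA nmZ cmV cm_nat.
  move: (n.+1%:R^-1) wn wn' (nmD (u - S u) (u' - S u')) => r; lra.
(* These infima are bounded above since each [K n] contains a Cesaro mean; as the sets shrink, [D]
   below is their limit. *)
pose d n := inf [set nm w ^+ 2 | w in K n].
have Kinf n : has_inf [set nm w ^+ 2 | w in K n].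
  split; last by exists 0 => _ [w _ <-]; apply: sqr_ge0.
  have [y [yP _]] := almost_fixed x n.
  by exists (nm (x - (y - S y)) ^+ 2); exists (x - (y - S y)) => //; split => //; exists y.
have dlb n w : K n w -> d n <= nm w ^+ 2.
  by move=> Kw; apply: ge_inf; [case: (Kinf n) | exists w].
have dsup : has_sup (range d).
  split; first by exists (d 0%N); exists 0%N.
  exists ((M * nm x) ^+ 2) => _ [n _ <-].
  have [y [yP yM]] := almost_fixed x n.
  have Ky : K n (x - (y - S y)) by split => //; exists y.
  apply: le_trans (dlb _ _ Ky) _.
  by rewrite !expr2; apply: ler_pM => //; apply: nm_ge0.
pose D := sup (range d).
have dD n : d n <= D by apply: sup_ubound; [case: dsup | exists n].
have /choice[w wP] n : exists w, K n w /\ nm w ^+ 2 < D + (n.+1%:R)^-1.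
  have [|_ [w Kw <-] wn] := @inf_adherent _ _ (n.+1%:R)^-1 _ (Kinf n).
    by rewrite invr_gt0 ltr0n.
  by exists w; split => //; apply: lt_le_trans wn _; rewrite lerD2r; exact: dD n.
have wK n m : (n <= m)%N -> K n (w m).
  by move=> nm_; apply: Kmono nm_ _; case: (wP m).
have wD n m : (n <= m)%N -> nm (w m) ^+ 2 <= D + (n.+1%:R)^-1.
  move=> nm_; have [_ /ltW wm] := wP m; apply: le_trans wm _.
  by rewrite lerD2l ler_natV.
have wC (r : R) : 0 < r -> exists n, forall m, (n <= m)%N -> nm (w n - w m) < r.
  (* The parallelogram law bounds the squared distance by [4 * (r^2 / 16)] twice, that is by
     [r^2 / 2]. *)
  move=> r0; have r2 : 0 < r ^+ 2 / 16 by rewrite divr_gt0 ?exprn_gt0.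
  have [_ [n1 _ <-] dn1] := sup_adherent r2 dsup.
  have [n2 n2P] := natV_small r2.
  exists (maxn n1 n2) => m nm_.
  set n := maxn n1 n2 in nm_ *.
  have n1n : (n1 <= n)%N by rewrite leq_maxl.
  have n2n : (n2 <= n)%N by rewrite leq_maxr.
  have n1m := leq_trans n1n nm_; have n2m := leq_trans n2n nm_.
  have := dlb _ _ (Kmid _ _ _ (wK _ _ n1n) (wK _ _ n1m)).
  rewrite half_nm => dmid.
  have := parallelogram ip_norm (w n) (w m).
  have := wD _ _ n2n; have := wD _ _ n2m; rewrite -/D in dn1 => h1 h2 h3.
  rewrite -(@ltr_pXn2r _ 2) ?nnegrE ?nm_ge0 ?ltW //.
  have aux (E s t dn a b p q : R) : 0 < t / 16 -> s < t / 16 ->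
      E - t / 16 < dn -> dn <= p / 4 -> b <= E + s -> a <= E + s ->
      q + p = 2 * (a + b) -> q < t by lra.
  exact: aux r2 n2P dn1 dmid h1 h2 h3.
have [z zP] := nm_complete wC.
have zfix : S z = z.
  apply/eqP; rewrite -subr_eq0; apply/eqP/nm_eq0/eqP.
  rewrite eq_le nm_ge0 andbT; apply/ler_addgt0Pl => r r0; rewrite addr0.
  have r3 : 0 < r / (2 * (M + 2)) by rewrite divr_gt0 // mulr_gt0 // ltr_wpDl.
  have [n1 n1P] := zP _ r3.
  have [n2 n2P] : exists n, (n.+1%:R)^-1 < r / 2 by apply: natV_small; rewrite divr_gt0.
  set n := maxn n1 n2.
  have n1n : (n1 <= n)%N by rewrite leq_maxl.
  have n2n : (n2 <= n)%N by rewrite leq_maxr.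
  have h1 := n1P _ n1n.
  have [_ /le_lt_trans/(_ n2P) h2] := wK _ _ n2n.
  have -> : S z - z = S (z - w n) - (w n - S (w n)) - (z - w n).
    by rewrite linearB !opprB !subrKA.
  apply: le_trans (nmB _ _) _; apply: le_trans (lerD (nmB _ _) (lexx _)) _.
  have h3 := S_pb 1 (z - w n); rewrite /= in h3.
  have h4 : (M + 2) * nm (z - w n) <= r / 2.
    rewrite -ler_pdivlMl ?ltr_wpDl // ltW // (lt_le_trans h1) // le_eqVlt.
    by apply/orP; left; apply/eqP; field; rewrite gt_eqF // ltr_wpDl.
  have := nm_ge0 (z - w n); lra.
have z0 := nofix _ zfix.
have [n nP] := zP _ e0.
have := nP n (leqnn n); rewrite z0 sub0r nmN.
have [[[y wE] _] _] := wP n.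
by exists y; rewrite -wE ltW.
Qed.

(** The operator enters the bound only through [M] and [nm (x - (y - S y))], so a [y] found for one
    operator still serves nearby ones with the same [M]. *)
Lemma ergodic_sum_le x y N :
  nm (\sum_(k < N) iter k S x) <=
  N%:R * (M * nm (x - (y - S y))) + (1 + M) * nm y.
Proof.
have -> : \sum_(k < N) iter k S x =
    \sum_(k < N) iter k S (x - (y - S y)) + (y - iter N S y).
  rewrite -coboundary_sum -big_split /=; apply: eq_bigr => k _.
  by rewrite -iterlinD subrK.
apply: le_trans (nmD _ _) _; apply: lerD.
  by apply: (@nm_sum_le _ _ _ (fun k => iter k S _)) => k _; apply: S_pb.
by apply: le_trans (nmB _ _) _; rewrite mulrDl mul1r lerD2l S_pb.
Qed.

End MeanErgodic.

(** * Characters of the circle and roots of unity *)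

Section Characters.
Variable R : realType.
Implicit Types x y t : R.

Lemma e2piD x y : e2pi (x + y) = e2pi x * e2pi y.
Proof.
apply/eqP; rewrite eq_complex /= !mulrDr cosD sinD eqxx /=.
by apply/eqP; rewrite addrC.
Qed.

Lemma e2pi0 : e2pi (0 : R) = 1.
Proof. by apply/eqP; rewrite eq_complex /= mulr0 cos0 sin0 !eqxx. Qed.

Lemma e2piN x : e2pi (- x) = (e2pi x)^*.
Proof. by apply/eqP; rewrite eq_complex /= mulrN cosN sinN !eqxx. Qed.

Lemma e2piX x n : e2pi x ^+ n = e2pi (n%:R * x).
Proof.
elim: n => [|n IH]; first by rewrite mul0r e2pi0.
by rewrite exprS IH -e2piD; congr e2pi; rewrite -addn1 natrD; ring.
Qed.

Lemma cm_e2pi x : cm (e2pi x) = 1.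
Proof.
apply/eqP; rewrite -(@eqrXn2 _ 2) ?cm_ge0 // expr1n; apply/eqP/rc_inj.
by rewrite -mulJ_cm -e2piN -e2piD subrr e2pi0.
Qed.

Lemma e2pi_nat n : e2pi (n%:R : R) = 1.
Proof.
rewrite -[n%:R]mulr1 -e2piX; suff -> : e2pi (1 : R) = 1 by rewrite expr1n.
apply/eqP; rewrite eq_complex /= mulr1 mulr_natl cos2pi eqxx /=.
by rewrite mulr2n sinD sinpi mul0r mulr0 addr0.
Qed.

Lemma e2pi_neq1 x : x != 0 -> `|x| < 1 -> e2pi x != 1.
Proof.
move=> x0 x1; apply/negP => /eqP/(congr1 (@cre R)); rewrite /cre /=.
have -> : cos (2 * pi * x) = cos (2 * pi * `|x|).
  by case: (ler0P x) => // _; rewrite mulrN cosN.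
have -> : 2 * pi * `|x| = (pi * `|x|) *+ 2 by ring.
rewrite cos_mulr2n cos2sin2.
have : 0 < sin (pi * `|x|).
  by rewrite sin_gt0_pi // mulr_gt0 ?pi_gt0 ?normr_gt0 //= gtr_pMr ?pi_gt0.
move: (sin _) => s s0 h; have : s ^+ 2 = 0.
  by move: h; rewrite mulr2n /GRing.one /= => h; lra.
by move/eqP; rewrite sqrf_eq0 gt_eqF.
Qed.

(** Distinct [a, b < P] differ by less than [P], so the ratio [e2pi d] of the geometric sum is not
    1, while its [P]-th power is. *)
Lemma char_orthogonality (P a b : nat) : (a < P)%N -> (b < P)%N ->
  \sum_(v < P) e2pi (v%:R / P%:R : R) ^+ a * (e2pi (v%:R / P%:R) ^+ b)^*
  = P%:R * (a == b)%:R.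
Proof.
move=> aP bP; have P0 : (P%:R : R) != 0 by rewrite pnatr_eq0 -lt0n (leq_ltn_trans _ aP).
pose d : R := (a%:R - b%:R) / P%:R.
under eq_bigr => v _.
  rewrite !e2piX -e2piN -e2piD.
  rewrite (_ : _ + _ = v%:R * d); last by rewrite /d; field.
  rewrite -e2piX; over.
have [ab|ab] := eqVneq a b.
  rewrite mulr1; under eq_bigr do rewrite e2piX /d ab subrr mul0r mulr0 e2pi0.
  by rewrite sumr_const card_ord.
rewrite mulr0; have dn : e2pi d != 1.
  apply: e2pi_neq1.
    by rewrite mulf_neq0 ?invr_eq0 // subr_eq0 eqr_nat.
  rewrite normrM normfV [`|P%:R|]ger0_norm // ltr_pdivrMr ?lt0r ?P0 ?ler0n //.
  have a' : (a%:R : R) < P%:R by rewrite ltr_nat.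
  have b' : (b%:R : R) < P%:R by rewrite ltr_nat.
  have := ler0n R a; have := ler0n R b.
  by rewrite mul1r ltr_norml; lra.
have : (e2pi d - 1) * \sum_(v < P) e2pi d ^+ v = 0.
  rewrite -subrX1 e2piX mulrC divfK // e2piD e2piN !e2pi_nat mul1r.
  by rewrite rmorph1 subrr.
by move/eqP; rewrite mulf_eq0 subr_eq0 (negPf dn) => /eqP.
Qed.

Lemma e2pi_near (t e : R) : 0 < e ->
  \forall s \near t, cm (e2pi s - e2pi t) < e.
Proof.
move=> e0.
have lin : {for t, continuous (fun s : R => 2 * pi * s)}.
  by apply: cvgM; [exact: cvg_cst | exact: cvg_id].
have cc : {for t, continuous (fun s : R => cos (2 * pi * s))}.
  by apply: continuous_comp; [exact: lin | exact: continuous_cos].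
have cs : {for t, continuous (fun s : R => sin (2 * pi * s))}.
  by apply: continuous_comp; [exact: lin | exact: continuous_sin].
have e2 : 0 < e / 2 by rewrite divr_gt0.
have c1 : \forall s \near t, `|cos (2 * pi * t) - cos (2 * pi * s)| < e / 2.
  by move/cvgrPdist_lt : cc; apply.
have c2 : \forall s \near t, `|sin (2 * pi * t) - sin (2 * pi * s)| < e / 2.
  by move/cvgrPdist_lt : cs; apply.
near=> s.
have -> : e2pi s - e2pi t = rc (cos (2 * pi * s) - cos (2 * pi * t)) +
   'i%C * rc (sin (2 * pi * s) - sin (2 * pi * t)).
  by apply/eqP; rewrite eq_complex /= ?(mul0r, mul1r, mulr0, oppr0, subr0, addr0, add0r) !eqxx.
apply: le_lt_trans (cmD _ _) _; rewrite cmM !cm_rc.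
have -> : cm ('i%C : R[i]) = 1.
  by rewrite /cm normc_def /= expr0n expr1n add0r sqrtr1.
rewrite mul1r [e]splitr distrC [`|sin _ - _|]distrC; apply: ltrD.
- by near: s; exact: c1.
- by near: s; exact: c2.
Unshelve. all: by end_near. Qed.

End Characters.

(** * Ergodic sums, uniformly over the circle *)

Section UniformErgodic.
Variables (R : realType) (H : completeNormedModType R[i]).
Variable ip : {dot H for Num.conj}.
Hypothesis ip_norm : forall x : H, ip x x = `|x| ^+ 2.
Variables (T : {linear H -> H}) (M : R).
Hypothesis M0 : 0 <= M.
Hypothesis T_pb : forall n y, nm (iter n T y) <= M * nm y.
Hypothesis T_spec : forall (z : R[i]) y, cm z = 1 -> T y = z *: y -> y = 0.

(** The coboundary chosen at the angle [t] serves all nearby angles [s], since [y - S s y] moves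
    only by [(e2pi s - e2pi t) *: T y]. This gives a common threshold near each [t], as the covering
    form of compactness requires. *)
Lemma uniform_ergodic x (e : R) : 0 < e ->
  exists N0, forall N, (N0 <= N)%N -> forall t : R, 0 <= t <= 1 ->
  nm (\sum_(n < N) e2pi t ^+ n *: iter n T x) <= N%:R * e.
Proof.
move=> e0.
pose S t : {linear H -> H} := e2pi t \*: T.
have SE t n y : iter n (S t) y = e2pi t ^+ n *: iter n T y.
  elim: n => [|n IH]; first by rewrite scale1r.
  by rewrite iterS IH /S /= linearZ /= scalerA -exprS.
have S_pb t n y : nm (iter n (S t) y) <= M * nm y.
  by rewrite SE nmZ cmX cm_e2pi expr1n mul1r.
have S_fix t z : S t z = z -> z = 0.
  move=> Sz; apply: (@T_spec (e2pi t)^-1); first by rewrite cmV cm_e2pi invr1.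
  have : e2pi t *: T z = z by [].
  move=> {2}<-; rewrite scalerA mulVf ?scale1r //.
  by apply/negP => /eqP h; have := cm_e2pi t; rewrite h cm0 => /esym/eqP; rewrite oner_eq0.
pose P N t := nm (\sum_(n < N) e2pi t ^+ n *: iter n T x) <= N%:R * e.
have /compact_near_coveringP/(_ nat \oo P _) :=
  @segment_compact R 0 1.
case; last first.
  move=> N0 _ NP; exists N0 => N /NP NP' t t01.
  by apply: (NP' t); rewrite /= in_itv.
move=> t _.
(* Spent twice, for [y] at [t] and for the move from [t] to [s]; multiplied by [M] this is at most
   [e / 2]. The boundary term [(1 + M) * nm y] takes the other half. *)
have e4 : 0 < e / (4 * (M + 1)) by rewrite divr_gt0 // mulr_gt0 // ltr_wpDl.
have [y yP] := coboundary_dense ip_norm M0 (S_pb t) (S_fix t) x e4.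
have My : 0 < M * nm y + 1 by rewrite ltr_wpDl // mulr_ge0 ?nm_ge0.
have h1 := e2pi_near t (divr_gt0 e4 My).
near=> s N; rewrite /P /=.
under eq_bigr do rewrite -SE.
apply: le_trans (ergodic_sum_le (S_pb s) x y N) _.
have : nm (x - (y - S s y)) <= e / (2 * (M + 1)).
  have -> : x - (y - S s y) = (x - (y - S t y)) + (e2pi s - e2pi t) *: T y.
    by rewrite scalerBl /S /= !opprB -[RHS]addrA; congr (_ + _); rewrite [RHS]addrC subrKA.
  apply: le_trans (nmD _ _) _; rewrite nmZ.
  have h2 : cm (e2pi s - e2pi t) < e / (4 * (M + 1)) / (M * nm y + 1) by near: s.
  have h3 : cm (e2pi s - e2pi t) * nm (T y) <= e / (4 * (M + 1)).
    apply: (@le_trans _ _ (e / (4 * (M + 1)) / (M * nm y + 1) * (M * nm y + 1))).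
      apply: ler_pM; rewrite ?cm_ge0 ?nm_ge0 ?ltW //.
      by apply: le_lt_trans (T_pb 1 y) _; rewrite ltrDl.
    by rewrite divfK // gt_eqF.
  apply: le_trans (lerD yP h3) _; rewrite le_eqVlt; apply/orP; left; apply/eqP.
  by field; rewrite gt_eqF // ltr_wpDl.
have : (1 + M) * nm y <= N%:R * (e / 2).
  rewrite -ler_pdivrMr ?divr_gt0 //; near: N; exact: nbhs_infty_ger.
have : M * (e / (2 * (M + 1))) <= e / 2.
  rewrite -[leRHS]mul1r [leRHS]mulrC -subr_ge0.
  rewrite (_ : _ - _ = e / (2 * (M + 1))).
    by rewrite ltW // divr_gt0 // mulr_gt0 // ltr_wpDl.
  by field; rewrite gt_eqF // ltr_wpDl.
move: (nm (x - _)) (e / _) => a b h1' h2' h3'.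
have hN : (0 : R) <= N%:R by [].
have : N%:R * (M * a) <= N%:R * (e / 2).
  by apply: ler_wpM2l => //; apply: le_trans h1'; apply: ler_wpM2l.
lra.
Unshelve. all: by end_near. Qed.

End UniformErgodic.

(** * Elementary inequalities for finite sums *)

Section FiniteSums.
Variable R : realType.

Lemma sqr_sum_le (N : nat) (a : nat -> R) :
  (\sum_(i < N) a i) ^+ 2 <= N%:R * \sum_(i < N) a i ^+ 2.
Proof.
have [->|N0] := posnP N; first by rewrite !big_ord0 expr0n mul0r.
set s := \sum_(i < N) a i; set q := \sum_(i < N) _.
have : 0 <= \sum_(i < N) (N%:R * a i - s) ^+ 2.
  by apply: sumr_ge0 => i _; apply: sqr_ge0.
have -> : \sum_(i < N) (N%:R * a i - s) ^+ 2 = N%:R * (N%:R * q - s ^+ 2).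
  transitivity (\sum_(i < N) (N%:R ^+ 2 * a i ^+ 2 - (2 * N%:R * s) * a i + s ^+ 2)).
    by apply: eq_bigr => i _; ring.
  rewrite big_split /= sumrB -!mulr_sumr -/q -/s sumr_const card_ord -mulr_natl.
  by ring.
by rewrite pmulr_rge0 ?ltr0n // subr_ge0.
Qed.

Lemma sum_le_const (n : nat) (F : nat -> R) (a : R) :
  (forall i, (i < n)%N -> F i <= a) -> \sum_(i < n) F i <= n%:R * a.
Proof.
move=> h; rewrite mulr_natl -[X in _ *+ X]card_ord -sumr_const.
by apply: ler_sum => i _; apply: h.
Qed.

Lemma cm_sum_le (n : nat) (F : nat -> R[i]) (a : R) :
  (forall i, (i < n)%N -> cm (F i) <= a) -> cm (\sum_(i < n) F i) <= n%:R * a.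
Proof.
move=> h; apply: le_trans (cm_sum _ _ _) _.
exact: (@sum_le_const _ (fun i => cm (F i))).
Qed.

(** Entries above the diagonal are conjugate to those below it; counting the diagonal twice only
    weakens the bound. *)
Lemma hermitian_sum_le (n : nat) (Z : nat -> nat -> R[i]) :
  (forall j k, Z k j = (Z j k)^*) ->
  cm (\sum_(j < n) \sum_(k < n) Z j k) <=
  2 * \sum_(j < n) \sum_(k < n | (k <= j)%N) cm (Z j k).
Proof.
move=> Zh; apply: le_trans (cm_sum _ _ _) _.
apply: (@le_trans _ _ (\sum_(j < n) (\sum_(k < n | (k <= j)%N) cm (Z j k) +
    \sum_(k < n | (j <= k)%N) cm (Z j k)))).
  apply: ler_sum => j _; apply: le_trans (cm_sum _ _ _) _.
  rewrite (bigID (fun k : 'I_n => (k <= j)%N)) /= lerD2l.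
  rewrite [leRHS](bigID (fun k : 'I_n => (j < k)%N)) /=.
  rewrite [X in _ <= X + _](_ : _ = \sum_(k < n | ~~ (k <= j)%N) cm (Z j k)).
    by rewrite lerDl sumr_ge0 // => k _; apply: cm_ge0.
  apply: eq_bigl => k; rewrite -ltnNge.
  by case: ltngtP.
rewrite big_split /= mulr2n mulrDl mul1r lerD2l.
rewrite (exchange_big_dep xpredT) //=.
rewrite le_eqVlt; apply/orP; left; apply/eqP.
by apply: eq_bigr => j _; apply: eq_bigr => k _; rewrite Zh cmJ.
Qed.

End FiniteSums.

(** * Averaged correlations along an orbit *)

Section Correlations.
Variables (R : realType) (H : normedModType R[i]).
Variable ip : {dot H for Num.conj}.
Hypothesis ip_norm : forall x : H, ip x x = `|x| ^+ 2.
Local Notation C := R[i].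

Lemma ip_lincomb (n : nat) (c : nat -> C) (u : nat -> H) :
  ip (\sum_(j < n) c j *: u j) (\sum_(j < n) c j *: u j) =
  \sum_(j < n) \sum_(k < n) c j * (c k)^* * ip (u j) (u k).
Proof.
rewrite ip_suml; apply: eq_bigr => j _; rewrite ip_sumr.
by apply: eq_bigr => k _; rewrite ipZl ipZr mulrA.
Qed.

(** Averaging [|sum_j z^j u_j|^2] times the conjugate of [sum_d z^d p_d] over the roots of unity of
    order [2n] keeps exactly the terms with [j = k + d]: both sides are below [2n], so congruence is
    equality. The second factor is at most [G], and Parseval evaluates the average of the first. *)
Lemma fourier_bound (n : nat) (u : nat -> H) (p : nat -> C) (G : R) :
  (forall t : R, 0 <= t <= 1 -> cm (\sum_(d < n) e2pi t ^+ d * p d) <= G) ->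
  cm (\sum_(j < n) \sum_(k < n | (k <= j)%N) ip (u j) (u k) * (p (j - k)%N)^*)
  <= G * \sum_(j < n) nm (u j) ^+ 2.
Proof.
move=> pG; have [->|n0] := posnP n; first by rewrite !big_ord0 cm0 mulr0.
pose P := (n + n)%N; pose z (v : 'I_P) := e2pi (v%:R / P%:R : R).
have P0 : (0 : R) < P%:R by rewrite ltr0n addn_gt0 n0.
have PC0 : (P%:R : C) != 0 by rewrite pnatr_eq0 -lt0n addn_gt0 n0.
have zP (v : 'I_P) : 0 <= (v%:R / P%:R : R) <= 1.
  apply/andP; split; first by rewrite divr_ge0.
  by rewrite ler_pdivrMr // mul1r ler_nat ltnW.
pose U v := \sum_(j < n) z v ^+ j *: u j.
pose g v := \sum_(d < n) z v ^+ d * p d.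
have UE v : ip (U v) (U v) =
    \sum_(j < n) \sum_(k < n) z v ^+ j * (z v ^+ k)^* * ip (u j) (u k).
  exact: ip_lincomb.
have sumU : \sum_v nm (U v) ^+ 2 = P%:R * \sum_(j < n) nm (u j) ^+ 2.
  apply: rc_inj; rewrite rc_sum rcM rc_nat rc_sum mulr_sumr.
  under eq_bigr do rewrite -(ip_nm ip_norm) UE.
  rewrite exchange_big /=; apply: eq_bigr => j _.
  rewrite exchange_big /= (bigD1 j) //= [X in _ + X]big1 ?addr0; last first.
    move=> k kj; rewrite -mulr_suml char_orthogonality ?ltn_addl ?ltn_addr //.
    by rewrite eq_sym [(_ == _)](negPf kj) mulr0 mul0r.
  rewrite -mulr_suml char_orthogonality ?ltn_addr // eqxx mulr1.
  by rewrite -(ip_nm ip_norm).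
set W := \sum_(j < n) _.
have WE : P%:R * W = \sum_v ip (U v) (U v) * (g v)^*.
  have -> : \sum_v ip (U v) (U v) * (g v)^* = \sum_v \sum_(j < n) \sum_(k < n)
      \sum_(d < n) z v ^+ j * (z v ^+ (k + d))^* * (ip (u j) (u k) * (p d)^*).
    apply: eq_bigr => v _; rewrite UE mulr_suml; apply: eq_bigr => j _.
    rewrite mulr_suml; apply: eq_bigr => k _.
    rewrite /g rmorph_sum mulr_sumr; apply: eq_bigr => d _.
    by rewrite exprD !cjM; ring.
  rewrite exchange_big mulr_sumr /=; apply: eq_bigr => j _.
  rewrite exchange_big mulr_sumr /= big_mkcond /=; apply: eq_bigr => k _.
  rewrite exchange_big /=.
  under eq_bigr => d _.
    rewrite -mulr_suml char_orthogonality; [|by rewrite ltn_addr|].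
      over.
    by rewrite -addnS leq_add // ltnW.
  case: leqP => [kj|jk].
    have dn : (j - k < n)%N by rewrite (leq_ltn_trans (leq_subr _ _)).
    rewrite (bigD1 (Ordinal dn)) //= subnKC // eqxx mulr1 big1 ?addr0 //.
    move=> d dj; case: eqP => [jE|_]; last by rewrite mulr0 mul0r.
    by case/eqP: dj; apply/val_inj; rewrite /= jE addKn.
  rewrite big1 // => d _; case: eqP => [jE|_]; last by rewrite mulr0 mul0r.
  by move: jk; rewrite jE ltnNge leq_addr.
rewrite -(ler_pM2l P0) mulrCA -sumU -[P%:R]cm_nat -cmM WE mulr_sumr.
apply: le_trans (cm_sum _ _ _) _; apply: ler_sum => v _.
rewrite cmM cmJ (ip_nm ip_norm) cm_rc ger0_norm ?sqr_ge0 // mulrC.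
by apply: ler_wpM2r; [apply: sqr_ge0 | apply: pG].
Qed.

Variables (T : {linear H -> H}) (A : R) (x : H).
Hypothesis T_le : forall n y, nm (iter n T y) <= A * nm y.
Hypothesis x_le : forall n, nm (iter n T x) <= A.
Implicit Types J n j k d : nat.

Let A0 : 0 <= A. Proof. exact: le_trans (nm_ge0 _) (x_le 0). Qed.

(** Gram matrix of the orbit for the form [J^-1 * sum_(i < J) ip (T^i u) (T^i v)]; it vanishes for
    [J = 0], where [J^-1] is 0. *)
Definition Psi J j k : C :=
  J%:R^-1 * \sum_(i < J) ip (iter (i + j) T x) (iter (i + k) T x).

Definition phi J d : C := Psi J d 0.

Lemma cm_corr j k : cm (ip (iter j T x) (iter k T x)) <= A ^+ 2.
Proof.
apply: le_trans (ip_CS ip_norm _ _) _.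
by rewrite expr2; apply: ler_pM; rewrite ?nm_ge0.
Qed.

Lemma cm_Psi J j k : cm (Psi J j k) <= A ^+ 2.
Proof.
have [->|J0] := posnP J; first by rewrite /Psi invr0 mul0r cm0 sqr_ge0.
rewrite cmM cmV cm_nat ler_pdivrMl ?ltr0n //.
apply: (@cm_sum_le _ _ (fun i => ip (iter (i + j) T x) (iter (i + k) T x))).
by move=> i _; apply: cm_corr.
Qed.

(** The left side is the averaged form taken at the weighted sum and at [x], so Cauchy-Schwarz
    applies term by term. The bound is free of [J]; through it, estimates on vectors become
    estimates on correlations. *)
Lemma cm_sum_phi J N (w : nat -> C) (d : nat -> nat) :
  cm (\sum_(i < N) w i * phi J (d i)) <=
  A ^+ 2 * nm (\sum_(i < N) w i *: iter (d i) T x).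
Proof.
set y := \sum_(i < N) w i *: _.
have [->|J0] := posnP J.
  rewrite big1 ?cm0 ?mulr_ge0 ?sqr_ge0 ?nm_ge0 // => i _.
  by rewrite /phi /Psi invr0 mul0r mulr0.
have -> : \sum_(i < N) w i * phi J (d i) =
    J%:R^-1 * \sum_(q < J) ip (iter q T y) (iter q T x).
  under eq_bigr do rewrite /phi /Psi mulrCA mulr_sumr.
  rewrite -mulr_sumr exchange_big /=; congr (_ * _); apply: eq_bigr => q _.
  rewrite iterlin_sum ip_suml; apply: eq_bigr => i _.
  by rewrite iterlinZ ipZl addn0 iterD.
rewrite cmM cmV cm_nat ler_pdivrMl ?ltr0n //.
apply: (@cm_sum_le _ _ (fun q => ip (iter q T y) (iter q T x))) => q _.
apply: le_trans (ip_CS ip_norm _ _) _.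
rewrite expr2 mulrAC; apply: ler_pM; rewrite ?nm_ge0 //.
Qed.

(** Shifting the range of summation by one exchanges two boundary terms of modulus at most [A ^+ 2];
    this is done [k] times. *)
Lemma Psi_shift J j k : (k <= j)%N ->
  cm (Psi J j k - phi J (j - k)) <= k%:R * (2 * A ^+ 2) / J%:R.
Proof.
move=> kj; rewrite mulrC /phi /Psi -mulrBr cmM cmV cm_nat.
apply: ler_wpM2l; first by rewrite invr_ge0.
pose s i := ip (iter (i + (j - k)) T x) (iter i T x).
have -> : \sum_(i < J) ip (iter (i + j) T x) (iter (i + k) T x) =
    \sum_(i < J) s (i + k)%N.
  by apply: eq_bigr => i _; rewrite /s -addnA subnKC.
have -> : \sum_(i < J) ip (iter (i + (j - k)) T x) (iter (i + 0) T x) =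
    \sum_(i < J) s i by apply: eq_bigr => i _; rewrite addn0.
have s_le i : cm (s i) <= A ^+ 2 by apply: cm_corr.
move: s s_le => {j kj} s s_le; elim: k => [|k IH].
  rewrite mul0r (_ : _ - _ = 0) ?cm0 //; apply/eqP; rewrite subr_eq0; apply/eqP.
  by apply: eq_bigr => i _; rewrite addn0.
have step : \sum_(i < J) s (i + k.+1)%N = \sum_(i < J) s (i + k)%N + (s (J + k)%N - s k).
  elim: J {IH} => [|J IH]; first by rewrite !big_ord0 subrr addr0.
  by rewrite !big_ord_recr /= IH addnS addSn; ring.
rewrite step (_ : _ + _ - _ = (\sum_(i < J) s (i + k)%N - \sum_(i < J) s i) +
  (s (J + k)%N - s k)); last by ring.
apply: le_trans (cmD _ _) _; rewrite -[k.+1]addn1 natrD mulrDl mul1r.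
apply: lerD IH _; apply: le_trans (cmD _ _) _.
by rewrite cmN mulr2n mulrDl mul1r; apply: lerD; apply: s_le.
Qed.

(* Testing against characters: [phi] is compared with the nonnegative
   trigonometric polynomials [|sum_j z^j T^(i+j) x|^2] at roots of unity, which
   are bounded on average, while [sum_d z^d phi(d)] is uniformly small. *)
Lemma phi_l2 J n (eta : R) : (0 < J)%N ->
  (forall t : R, 0 <= t <= 1 ->
     nm (\sum_(d < n) e2pi t ^+ d *: iter d T x) <= n%:R * eta) ->
  \sum_(j < n) \sum_(k < n | (k <= j)%N) cm (phi J (j - k)) ^+ 2 <=
  n%:R ^+ 2 * (A ^+ 4 * eta + n%:R * (2 * A ^+ 4) / J%:R).
Proof.
move=> J0 teta.
have J0R : (0 : R) < J%:R by rewrite ltr0n.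
have JC0 : (J%:R : C) != 0 by rewrite pnatr_eq0 -lt0n.
have gle t : 0 <= t <= 1 ->
    cm (\sum_(d < n) e2pi t ^+ d * phi J d) <= A ^+ 2 * (n%:R * eta).
  move=> t01; apply: le_trans (cm_sum_phi J n (fun d => e2pi t ^+ d) id) _.
  by apply: ler_wpM2l; [apply: sqr_ge0 | apply: teta].
set G := A ^+ 2 * (n%:R * eta) in gle.
have G0 : 0 <= G by apply: le_trans (gle 0 _); rewrite ?cm_ge0 // lexx ler01.
(* The left side with one factor [phi J (j - k)] replaced by [Psi J j k]: an average over [i] of
   Gram matrices of the vectors [T^(i+j) x], so [fourier_bound] applies for each [i]. *)
pose B := \sum_(j < n) \sum_(k < n | (k <= j)%N) Psi J j k * (phi J (j - k))^*.
have Ble : cm B <= n%:R ^+ 2 * (A ^+ 4 * eta).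
  have -> : B = J%:R^-1 * \sum_(i < J) \sum_(j < n) \sum_(k < n | (k <= j)%N)
      ip (iter (i + j) T x) (iter (i + k) T x) * (phi J (j - k))^*.
    rewrite /B mulr_sumr [RHS](eq_bigr (fun i : 'I_J => \sum_(j < n)
      \sum_(k < n | (k <= j)%N) J%:R^-1 *
      (ip (iter (i + j) T x) (iter (i + k) T x) * (phi J (j - k))^*))).
      rewrite exchange_big /=; apply: eq_bigr => j _.
      rewrite exchange_big /=; apply: eq_bigr => k _.
      by rewrite /Psi -mulrA mulr_suml mulr_sumr.
    by move=> i _; rewrite mulr_sumr; apply: eq_bigr => j _; rewrite mulr_sumr.
  rewrite cmM cmV cm_nat ler_pdivrMl //.
  apply: (@cm_sum_le _ _ (fun i => \sum_(j < n) \sum_(k < n | (k <= j)%N)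
    ip (iter (i + j) T x) (iter (i + k) T x) * (phi J (j - k))^*)) => i _.
  apply: le_trans (@fourier_bound n (fun j => iter (i + j) T x) _ _ gle) _.
  have -> : n%:R ^+ 2 * (A ^+ 4 * eta) = G * (n%:R * A ^+ 2) by rewrite /G; ring.
  apply: ler_wpM2l => //.
  apply: (@sum_le_const _ _ (fun j => nm (iter (i + j) T x) ^+ 2)) => j _.
  by rewrite ler_pXn2r ?nnegrE ?nm_ge0.
have e1 : \sum_(j < n) \sum_(k < n | (k <= j)%N) rc (cm (phi J (j - k)) ^+ 2)
    = B + \sum_(j < n) \sum_(k < n | (k <= j)%N)
      (phi J (j - k) - Psi J j k) * (phi J (j - k))^*.
  rewrite -big_split /=; apply: eq_bigr => j _; rewrite -big_split /=.
  by apply: eq_bigr => k _; rewrite -mulrDl addrC subrK mulJ_cm.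
rewrite -[leLHS]ger0_norm; last first.
  by apply: sumr_ge0 => j _; apply: sumr_ge0 => k _; apply: sqr_ge0.
rewrite -cm_rc rc_sum.
under eq_bigr do rewrite rc_sum.
rewrite e1; apply: le_trans (cmD _ _) _; rewrite mulrDr; apply: lerD => //.
rewrite expr2 -mulrA.
apply: (@cm_sum_le _ _ (fun j => \sum_(k < n | (k <= j)%N)
      (phi J (j - k) - Psi J j k) * (phi J (j - k))^*)) => j jn.
rewrite big_mkcond.
apply: (@cm_sum_le _ _ (fun k => if (k <= j)%N then
      (phi J (j - k) - Psi J j k) * (phi J (j - k))^* else 0)) => k kn.
have b0 : 0 <= n%:R * (2 * A ^+ 4) / J%:R.
  by rewrite divr_ge0 // !mulr_ge0 // exprn_ge0.
case: ifP => kj; last by rewrite cm0.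
rewrite cmM cmJ -opprB cmN.
have -> : n%:R * (2 * A ^+ 4) / J%:R = n%:R * (2 * A ^+ 2) / J%:R * A ^+ 2.
  by field; rewrite gt_eqF.
apply: ler_pM; rewrite ?cm_ge0 ?cm_Psi //.
apply: le_trans (Psi_shift _ kj) _.
apply: ler_wpM2r; first by rewrite invr_ge0 ltW.
apply: ler_wpM2r; first by rewrite mulr_ge0 ?sqr_ge0.
by rewrite ler_nat ltnW.
Qed.

End Correlations.

(** * Van der Corput's inequality for power bounded operators *)

Section VanDerCorput.
Variables (R : realType) (H : normedModType R[i]).
Variable ip : {dot H for Num.conj}.
Hypothesis ip_norm : forall x : H, ip x x = `|x| ^+ 2.
Local Notation C := R[i].
Variables (T : {linear H -> H}) (A : R) (x : H).
Hypothesis T_le : forall n y, nm (iter n T y) <= A * nm y.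
Hypothesis x_le : forall n, nm (iter n T x) <= A.

Let A0 : 0 <= A. Proof. exact: le_trans (nm_ge0 _) (x_le 0). Qed.

Lemma creZ (r : R) (z : C) : cre (rc r * z) = r * cre z.
Proof. by case: z => a b; rewrite /cre /= mul0r subr0. Qed.

Lemma cre_sum (n : nat) (F : nat -> C) :
  cre (\sum_(i < n) F i) = \sum_(i < n) cre (F i).
Proof. by apply: (big_morph (@cre R)); [exact: creD|]. Qed.

Lemma PsiJ J j k : (Psi ip T x J j k)^* = Psi ip T x J k j.
Proof.
rewrite /Psi cjM cj_sum fmorphV rmorph_nat; congr (_ * _).
by apply: eq_bigr => i _; rewrite -ipJ.
Qed.

Lemma nm_term_le (c : nat -> C) (a : nat -> nat) i : (forall i, cm (c i) <= 1) ->
  nm (c i *: iter (a i) T x) <= A.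
Proof.
by move=> c1; rewrite nmZ -[leRHS]mul1r; apply: ler_pM; rewrite ?cm_ge0 ?nm_ge0.
Qed.

(** Replacing [i] by [i + j] alters the sum by [j] terms at each end, hence by at most [j * 2A]. *)
Lemma sliding_window (c : nat -> C) (a : nat -> nat) (N n : nat) :
  (forall i, cm (c i) <= 1) ->
  n%:R * nm (\sum_(i < N) c i *: iter (a i) T x) <=
  nm (\sum_(i < N) \sum_(j < n) c (i + j)%N *: iter (a (i + j)%N) T x) +
  n%:R * (n%:R * (2 * A)).
Proof.
move=> c1; pose u i := c i *: iter (a i) T x.
have shift j : nm (\sum_(i < N) u i - \sum_(i < N) u (i + j)%N) <= j%:R * (2 * A).
  elim: j => [|j IH].
    under [X in _ - X]eq_bigr do rewrite addn0.
    by rewrite subrr nm0 mul0r.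
  have step : \sum_(i < N) u (i + j.+1)%N = \sum_(i < N) u (i + j)%N + (u (N + j)%N - u j).
    elim: N {IH} => [|N IH]; first by rewrite !big_ord0 subrr addr0.
    rewrite !big_ord_recr /= IH addnS addSn -!addrA; congr (_ + _).
    by congr (_ + _); rewrite addrC.
  rewrite step opprD addrA; apply: le_trans (nmB _ _) _.
  rewrite -[j.+1]addn1 natrD mulrDl mul1r; apply: lerD => //.
  apply: le_trans (nmB _ _) _; rewrite mulr2n mulrDl mul1r.
  by apply: lerD; apply: nm_term_le.
rewrite -cm_nat -nmZ scaler_nat.
have -> : (\sum_(i < N) u i) *+ n = \sum_(i < N) \sum_(j < n) u (i + j)%N +
    \sum_(j < n) (\sum_(i < N) u i - \sum_(i < N) u (i + j)%N).
  rewrite [X in X + _]exchange_big -big_split /=.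
  under [RHS]eq_bigr do rewrite addrC subrK.
  by rewrite sumr_const card_ord.
apply: le_trans (nmD _ _) _; rewrite lerD2l cm_nat.
apply: (@nm_sum_le _ _ _ (fun j => \sum_(i < N) u i - \sum_(i < N) u (i + j)%N)).
move=> j jn; apply: le_trans (shift j) _.
by apply: ler_wpM2r; [rewrite mulr_ge0 | rewrite ler_nat ltnW].
Qed.

(* Power boundedness gives [|V| <= A |V'|] whenever [V = T^k V'] with
   [0 <= k < J]; averaging over [k] replaces the non invariant correlations
   [ip (T^j x) (T^k x)] by the almost invariant [Psi]. *)
Lemma window_sqr (J n b : nat) (c : nat -> C) (e : nat -> nat) : (0 < J)%N ->
  (J <= b)%N ->
  nm (\sum_(j < n) c j *: iter (b + e j) T x) ^+ 2 <=
  A ^+ 2 * cre (\sum_(j < n) \sum_(k < n)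
    c j * (c k)^* * Psi ip T x J (e j) (e k)).
Proof.
move=> J0 Jb; set S := \sum_(j < n) \sum_(k < n) _.
have JR : (0 : R) < J%:R by rewrite ltr0n.
pose W q := \sum_(j < n) c j *: iter (q + e j) T x.
have sumW : \sum_(q < J) nm (W q) ^+ 2 = J%:R * cre S.
  rewrite -creZ -[LHS]rcK rc_sum; congr cre.
  under eq_bigr => q _.
    rewrite -(ip_nm ip_norm) (ip_lincomb ip n c (fun j => iter (q + e j) T x)).
    over.
  rewrite rc_nat mulr_sumr exchange_big; apply: eq_bigr => j _.
  rewrite mulr_sumr exchange_big; apply: eq_bigr => k _.
  by rewrite /Psi mulrCA mulVKf ?mulr_sumr // pnatr_eq0 -lt0n.
rewrite -(ler_pM2l JR) [leRHS]mulrCA -sumW mulr_sumr mulr_natl.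
rewrite -[X in _ *+ X]card_ord -sumr_const; apply: ler_sum => q _.
have -> : \sum_(j < n) c j *: iter (b + e j) T x = iter (b - q) T (W q).
  rewrite iterlin_sum; apply: eq_bigr => j _; rewrite iterlinZ -iterD addnA subnK //.
  by rewrite (leq_trans _ Jb) // ltnW.
rewrite -exprMn ler_pXn2r ?nnegrE ?mulr_ge0 ?nm_ge0 //.
Qed.

(** The spread of a window is at most [r], so passing from [Psi] to [phi] costs [r / J]. The bounds
    [b] are left free because they come either from the size of the correlations or from
    cancellation in [i]; the condition on [K] is squared to avoid square roots. *)
Lemma van_der_corput (N n J r : nat) (a : nat -> nat) (c : nat -> C)
    (b : nat -> nat -> R) (K : R) :
  (0 < n)%N -> (0 < J)%N -> (forall i, cm (c i) <= 1) ->
  (forall i, (i < N)%N -> (J <= a i)%N) ->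
  (forall i i', (i <= i')%N -> (i' < N + n)%N -> (a i <= a i')%N) ->
  (forall i k, (i < N)%N -> (k < n)%N -> (a (i + k)%N <= a i + r)%N) ->
  (forall j k, (k <= j)%N -> (j < n)%N ->
     cm (\sum_(i < N) c (i + j)%N * (c (i + k)%N)^* *
           phi ip T x J (a (i + j)%N - a (i + k)%N)) <= b j k) ->
  0 <= K ->
  N%:R * (A ^+ 2 * (2 * \sum_(j < n) \sum_(k < n | (k <= j)%N)
     (b j k + N%:R * (r%:R * (2 * A ^+ 2) / J%:R)))) <= (n%:R * K) ^+ 2 ->
  nm (\sum_(i < N) c i *: iter (a i) T x) <= n%:R * (2 * A) + K.
Proof.
move=> n0 J0 c1 aJ amono agap ab K0 hK.
have nR : (0 : R) < n%:R by rewrite ltr0n.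
rewrite -(ler_pM2l nR); apply: le_trans (sliding_window a N n c1) _.
rewrite mulrDr addrC lerD2l.
pose V i := \sum_(j < n) c (i + j)%N *: iter (a (i + j)%N) T x.
(* Exponents relative to the start of the window, ready to be lowered by [window_sqr]. *)
pose e i j := (a (i + j)%N - a i)%N.
pose z i j k := c (i + j)%N * (c (i + k)%N)^* * Psi ip T x J (e i j) (e i k).
pose Z j k := \sum_(i < N) z i j k.
have aE i j : (i < N)%N -> (j < n)%N -> (a i + e i j = a (i + j))%N.
  by move=> iN jn; rewrite subnKC // amono ?leq_addr // -addnS leq_add // ltnW.
have V2 (i : 'I_N) : nm (V i) ^+ 2 <= A ^+ 2 * cre (\sum_(j < n) \sum_(k < n) z i j k).
  have -> : V i = \sum_(j < n) c (i + j)%N *: iter (a i + e i j) T x.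
    by apply: eq_bigr => j _; rewrite aE.
  exact: (@window_sqr J n (a i) (fun j => c (i + j)%N) (e i) J0 (aJ _ (ltn_ord i))).
rewrite -(@ler_pXn2r _ 2) ?nnegrE ?nm_ge0 ?mulr_ge0 ?ler0n //.
apply: le_trans hK.
apply: (@le_trans _ _ ((\sum_(i < N) nm (V i)) ^+ 2)).
  rewrite ler_pXn2r ?nnegrE ?nm_ge0 ?sumr_ge0 ?nm_sum // => i _.
  exact: nm_ge0.
apply: le_trans (sqr_sum_le N (fun i => nm (V i))) _.
apply: ler_wpM2l; first by [].
apply: (@le_trans _ _ (A ^+ 2 * cre (\sum_(j < n) \sum_(k < n) Z j k))).
  have -> : \sum_(j < n) \sum_(k < n) Z j k =
      \sum_(i < N) \sum_(j < n) \sum_(k < n) z i j k.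
    rewrite [RHS]exchange_big; apply: eq_bigr => j _.
    by rewrite [RHS]exchange_big.
  rewrite (@cre_sum N (fun i => \sum_(j < n) \sum_(k < n) z i j k)) mulr_sumr.
  by apply: ler_sum => i _; apply: V2.
apply: ler_wpM2l; first exact: sqr_ge0.
apply: le_trans (cre_le_cm _) _.
apply: le_trans (hermitian_sum_le _ _) _.
  move=> j k; rewrite /Z cj_sum; apply: eq_bigr => i _.
  by rewrite /z cjM PsiJ cjM conjCK [(c _)^* * _]mulrC.
apply: ler_wpM2l => //; apply: ler_sum => j _; apply: ler_sum => k kj.
have -> : Z j k = \sum_(i < N) c (i + j)%N * (c (i + k)%N)^* *
      phi ip T x J (a (i + j)%N - a (i + k)%N) +
    \sum_(i < N) c (i + j)%N * (c (i + k)%N)^* *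
      (Psi ip T x J (e i j) (e i k) - phi ip T x J (e i j - e i k)).
  rewrite -big_split; apply: eq_bigr => i _ /=.
  have -> : (a (i + j) - a (i + k) = e i j - e i k)%N.
    by rewrite /e subnBA ?aE // ?subnK // amono ?leq_addr // -?addnS leq_add // ltnW.
  by rewrite -mulrDr addrC subrK.
apply: le_trans (cmD _ _) _; apply: lerD; first exact: ab.
apply: (@cm_sum_le _ N (fun i => c (i + j)%N * (c (i + k)%N)^* *
      (Psi ip T x J (e i j) (e i k) - phi ip T x J (e i j - e i k)))) => i iN.
have kje : (e i k <= e i j)%N.
  by apply: leq_sub2r; apply: amono; rewrite ?leq_add2l // -addnS leq_add // ltnW.
rewrite !cmM cmJ -[leRHS]mul1r; apply: ler_pM; rewrite ?mulr_ge0 ?cm_ge0 //.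
  by rewrite -[leRHS]mul1r; apply: ler_pM; rewrite ?cm_ge0.
apply: le_trans (Psi_shift ip_norm x_le J kje) _.
apply: ler_wpM2r; first by rewrite invr_ge0.
apply: ler_wpM2r; first by rewrite mulr_ge0 ?sqr_ge0.
by rewrite ler_nat /e leq_subLR agap.
Qed.

End VanDerCorput.

(** * Negligible sequences of exponents, and the sequence of all integers *)

Section Negligible.
Variables (R : realType) (H : completeNormedModType R[i]).
Local Notation C := R[i].

(** [N0] is fixed before [c], so the weights may change with [N]; zero weights are allowed, so
    restricting to any set of indices is free. *)
Definition negligible (T : H -> H) (x : H) (a : nat -> nat) : Prop :=
  forall e : R, 0 < e -> exists N0, forall N, (N0 <= N)%N ->
  forall c : nat -> C, (forall i, cm (c i) <= 1) ->
  nm (\sum_(i < N) c i *: iter (a i) T x) <= N%:R * e.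

Lemma nat_ge (r : R) : exists N0, forall N, (N0 <= N)%N -> r <= N%:R.
Proof.
exists (Num.truncn r).+1 => N h; apply: ltW; apply: lt_le_trans (truncnS_gt r) _.
by rewrite ler_nat.
Qed.

Lemma common_threshold (P : nat -> nat -> Prop) n :
  (forall h, (h < n)%N -> exists N0, forall N, (N0 <= N)%N -> P h N) ->
  exists N0, forall N, (N0 <= N)%N -> forall h, (h < n)%N -> P h N.
Proof.
elim: n => [|n IH] hP; first by exists 0%N.
have [|N0 N0P] := IH; first by move=> h hn; apply: hP; rewrite ltnW.
have [N1 N1P] := hP n (ltnSn n).
exists (maxn N0 N1) => N; rewrite geq_max => /andP[h0 h1] h.
by rewrite ltnS leq_eqVlt => /orP[/eqP ->|hn]; [apply: N1P | apply: N0P].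
Qed.

Lemma tri_sum_const (n : nat) (r : R) : 0 <= r ->
  \sum_(j < n) \sum_(k < n | (k <= j)%N) r <= n%:R ^+ 2 * r.
Proof.
move=> r0; rewrite expr2 -mulrA.
apply: (@sum_le_const _ _ (fun j => \sum_(k < n | (k <= j)%N) r)) => j _.
rewrite big_mkcond; apply: (@sum_le_const _ _ (fun k => if (k <= j)%N then r else 0)).
by move=> k _; case: ifP.
Qed.

Variable ip : {dot H for Num.conj}.
Hypothesis ip_norm : forall x : H, ip x x = `|x| ^+ 2.
Variables (T : {linear H -> H}) (A : R) (x : H).
Hypothesis A1 : 1 <= A.
Hypothesis T_le : forall n y, nm (iter n T y) <= A * nm y.
Hypothesis x_le : forall n, nm (iter n T x) <= A.

Let A0 : 0 < A. Proof. exact: lt_le_trans A1. Qed.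

Lemma split_head (c : nat -> C) (a : nat -> nat) p N :
  (forall i, cm (c i) <= 1) ->
  nm (\sum_(i < p + N) c i *: iter (a i) T x) <=
  p%:R * A + nm (\sum_(i < N) c (p + i)%N *: iter (a (p + i)%N) T x).
Proof.
move=> c1; rewrite big_split_ord /=; apply: le_trans (nmD _ _) _.
rewrite lerD2r; apply: (@nm_sum_le _ _ _ (fun i => c i *: iter (a i) T x)) => i _.
exact: nm_term_le.
Qed.

(** Zero weights turn a sum starting at [s] into one starting at 0, the only kind that [negligible]
    speaks of. *)
Lemma pad_head (w : nat -> C) (u : nat -> H) s N :
  \sum_(i < N) w i *: u (s + i)%N =
  \sum_(i < s + N) (if (i < s)%N then 0 else w (i - s)%N) *: u i.
Proof.
rewrite big_split_ord /= [X in X + _]big1 ?add0r => [|i _]; last by rewrite ltn_ord scale0r.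
by apply: eq_bigr => i _; rewrite ltnNge leq_addr /= addKn.
Qed.

Lemma negligible_tail (a : nat -> nat) s :
  negligible T x (fun i => a (s + i)%N) -> negligible T x a.
Proof.
move=> an e e0; have e2 : 0 < e / 2 by rewrite divr_gt0.
have [N0 N0P] := an _ e2.
have [N1 N1P] := nat_ge (s%:R * A / (e / 2)).
exists (maxn (s + N0) N1) => N; rewrite geq_max => /andP[h0 h1] c c1.
have sN : (s <= N)%N by apply: leq_trans h0; rewrite leq_addr.
have NE : N = (s + (N - s))%N by rewrite subnKC.
have := split_head a s (N - s) c1; rewrite -NE => /le_trans; apply.
have h2 : (N0 <= N - s)%N by rewrite -(leq_add2l s) -NE.
have := N0P _ h2 (fun i => c (s + i)%N) (fun i => c1 _).
have := N1P _ h1; rewrite ler_pdivrMr //.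
have : (N - s)%:R * (e / 2) <= N%:R * (e / 2) by rewrite ler_pM2r // ler_nat leq_subr.
lra.
Qed.

Lemma negligible_step (a b : nat -> nat) : negligible T x b ->
  (forall i, a i = b i \/ a i = (b i).+1) -> negligible T x a.
Proof.
move=> bn ab e e0.
have eA : 0 < e / (2 * A) by rewrite divr_gt0 // mulr_gt0.
have [N0 N0P] := bn _ eA.
exists N0 => N h c c1.
pose c1' i := if a i == b i then c i else 0.
pose c2' i := if a i == b i then 0 else c i.
(* The indices with [a i = (b i).+1] give [T] applied to a sum along [b], at the cost of a factor
   [A]. *)
have -> : \sum_(i < N) c i *: iter (a i) T x =
    \sum_(i < N) c1' i *: iter (b i) T x + iter 1 T (\sum_(i < N) c2' i *: iter (b i) T x).
  rewrite iterlin_sum -big_split; apply: eq_bigr => i _ /=.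
  rewrite /c1' /c2'; case: eqP (ab i) => [->|ne [//|->]].
    by rewrite scale0r linear0 addr0.
  by rewrite scale0r add0r linearZ.
apply: le_trans (nmD _ _) _; apply: le_trans (lerD (lexx _) (T_le 1 _)) _.
have h1 : nm (\sum_(i < N) c1' i *: iter (b i) T x) <= N%:R * (e / (2 * A)).
  by apply: N0P => // i; rewrite /c1'; case: ifP; rewrite ?cm0.
have h2 : nm (\sum_(i < N) c2' i *: iter (b i) T x) <= N%:R * (e / (2 * A)).
  by apply: N0P => // i; rewrite /c2'; case: ifP; rewrite ?cm0.
have -> : N%:R * e = A * (N%:R * (e / (2 * A))) + A * (N%:R * (e / (2 * A))).
  by field; rewrite gt_eqF.
apply: lerD; last by rewrite ler_pM2l.
by apply: le_trans h1 _; rewrite ler_peMl // mulr_ge0 // ltW.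
Qed.

Hypothesis T_spec : forall (z : C) y, cm z = 1 -> T y = z *: y -> y = 0.

(** The differences of exponents do not depend on [i], so arbitrary weights leave no cancellation in
    [i]; it is the correlations themselves that are small, in mean square by [phi_l2]. *)
Lemma negligible_id : negligible T x id.
Proof.
move=> e e0.
(* [2 * A^2 * s] and [2 * A^6 * eta / s] both equal [e^2 / 64]; [Y / p] collects the errors
   proportional to [1 / J], and [p] makes it at most [e^2 / 64]. *)
pose s := e ^+ 2 / (128 * A ^+ 2).
have s0 : 0 < s by rewrite divr_gt0 ?exprn_gt0 // mulr_gt0 ?exprn_gt0.
pose eta := e ^+ 2 * s / (128 * A ^+ 6).
have eta0 : 0 < eta.
  by apply: divr_gt0; apply: mulr_gt0 => //; apply: exprn_gt0.
have [n0 n0P] := uniform_ergodic ip_norm (ltW A0) T_le T_spec x eta0.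
pose n := n0.+1; have {n0P} nP := n0P n (leqnSn n0).
have nR : (0 : R) < n%:R by rewrite ltr0n.
pose Y := 2 * A ^+ 2 * (2 * n%:R * A ^+ 4 / s + 2 * n%:R * A ^+ 2).
have Y0 : 0 < Y.
  by do ?[exact: nR|exact: ltr0n|apply: addr_gt0|apply: mulr_gt0|
    apply: exprn_gt0|rewrite invr_gt0].
have [p0 p0P] := nat_ge (64 * Y / e ^+ 2).
pose p := p0.+1; have {p0P} pP := p0P p (leqnSn p0).
have pR : (0 : R) < p%:R by rewrite ltr0n.
have [N1 N1P] := nat_ge ((p%:R * A + n%:R * (2 * A)) / (e / 2)).
exists (maxn p N1) => N; rewrite geq_max => /andP[h0 h1] c c1.
have NE : N = (p + (N - p))%N by rewrite subnKC.
have := split_head id p (N - p) c1; rewrite -NE => /le_trans; apply.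
set N' := (N - p)%N.
pose b j k := N'%:R * cm (phi ip T x p (j - k)).
have N'N : (N'%:R : R) <= N%:R by rewrite ler_nat leq_subr.
apply: (@le_trans _ _ (p%:R * A + (n%:R * (2 * A) + N%:R * (e / 2)))); last first.
  by have := N1P _ h1; rewrite ler_pdivrMr ?divr_gt0 //; lra.
rewrite lerD2l.
(* [p] is both the number of discarded terms and the averaging length: the remaining exponents
   [p + i] are at least [p]. *)
apply: (@van_der_corput _ _ _ ip_norm T A x T_le x_le N' n p n (fun i => p + i)%N
  (fun i => c (p + i)%N) b) => //=.
- by move=> i _; rewrite leq_addr.
- by move=> i i' ii' _; rewrite leq_add2l.
- by move=> i k _ kn; rewrite addnA leq_add2l ltnW.
- move=> j k kj jn; rewrite /b.
  under eq_bigr do rewrite !subnDl.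
  apply: (@cm_sum_le _ N' (fun i => c (p + (i + j))%N * (c (p + (i + k))%N)^* *
    phi ip T x p (j - k))) => i _.
  rewrite !cmM cmJ -[leRHS]mul1r; apply: ler_pM; rewrite ?mulr_ge0 ?cm_ge0 //.
  by rewrite -[leRHS]mul1r; apply: ler_pM; rewrite ?cm_ge0.
- by rewrite mulr_ge0 // divr_ge0 // ltW.
pose rho := n%:R * (2 * A ^+ 2) / p%:R.
have rho0 : 0 <= rho by rewrite divr_ge0 ?mulr_ge0 ?exprn_ge0 // ltW.
have bs : \sum_(j < n) \sum_(k < n | (k <= j)%N) (b j k + N'%:R * rho) <=
    N'%:R * (n%:R ^+ 2 * (s + rho + (A ^+ 4 * eta + n%:R * (2 * A ^+ 4) / p%:R) / s)).
  apply: (@le_trans _ _ (N'%:R * (\sum_(j < n) \sum_(k < n | (k <= j)%N) (s + rho) +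
      (\sum_(j < n) \sum_(k < n | (k <= j)%N) cm (phi ip T x p (j - k)) ^+ 2) / s))).
    rewrite mulr_suml -big_split mulr_sumr; apply: ler_sum => j _ /=.
    rewrite mulr_suml -big_split mulr_sumr; apply: ler_sum => k _ /=.
    rewrite /b -mulrDr; apply: ler_wpM2l => //.
    set v := cm _; rewrite addrAC lerD2r.
    (* [v <= s + v^2 / s] passes from the mean square to the mean. *)
    rewrite -(ler_pM2r s0) mulrDl divfK ?gt_eqF //.
    have := sqr_ge0 (v - s); have := cm_ge0 (phi ip T x p (j - k)); rewrite -/v.
    nra.
  apply: ler_wpM2l => //; rewrite mulrDr; apply: lerD.
    by apply: tri_sum_const; rewrite addr_ge0 // ltW.
  rewrite mulrA; apply: ler_wpM2r; first by rewrite invr_ge0 ltW.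
  by apply: phi_l2 => //; exact: nP.
have tot : 2 * A ^+ 2 * (s + rho + (A ^+ 4 * eta + n%:R * (2 * A ^+ 4) / p%:R) / s)
    <= (e / 2) ^+ 2.
  have -> : 2 * A ^+ 2 * (s + rho + (A ^+ 4 * eta + n%:R * (2 * A ^+ 4) / p%:R) / s)
     = e ^+ 2 / 64 + e ^+ 2 / 64 + Y / p%:R.
    by rewrite /eta /Y /rho /s; field; rewrite !gt_eqF.
  have : Y / p%:R <= e ^+ 2 / 64.
    rewrite ler_pdivrMr // mulrAC ler_pdivlMr // mulrC.
    by move: pP; rewrite ler_pdivrMr ?exprn_gt0 // [leRHS]mulrC.
  have : 0 <= e ^+ 2 by apply: sqr_ge0.
  have -> : (e / 2) ^+ 2 = e ^+ 2 / 4 by field.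
  by move: (Y / _) (e ^+ 2) => u v; lra.
apply: (@le_trans _ _ (N'%:R * (A ^+ 2 * (2 * (N'%:R * (n%:R ^+ 2 *
   (s + rho + (A ^+ 4 * eta + n%:R * (2 * A ^+ 4) / p%:R) / s))))))).
  apply: ler_wpM2l => //; apply: ler_wpM2l; first exact: sqr_ge0.
  by apply: ler_wpM2l.
move: (s + rho + _) tot => q tot.
have -> : N'%:R * (A ^+ 2 * (2 * (N'%:R * (n%:R ^+ 2 * q)))) =
  (N'%:R * n%:R) ^+ 2 * (2 * A ^+ 2 * q) by ring.
have -> : (n%:R * (N%:R * (e / 2))) ^+ 2 = (N%:R * n%:R) ^+ 2 * (e / 2) ^+ 2 by ring.
apply: (@le_trans _ _ ((N'%:R * n%:R) ^+ 2 * (e / 2) ^+ 2)).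
  by apply: ler_wpM2l => //; apply: sqr_ge0.
apply: ler_wpM2r; first exact: sqr_ge0.
rewrite ler_pXn2r ?nnegrE ?mulr_ge0 //.
by apply: ler_wpM2r.
Qed.

End Negligible.

(** * Reduction of a slowly varying sequence to its differences *)

Section VanDerCorputReduction.
Variables (R : realType) (H : completeNormedModType R[i]).
Local Notation C := R[i].
Variable ip : {dot H for Num.conj}.
Hypothesis ip_norm : forall x : H, ip x x = `|x| ^+ 2.
Variables (T : {linear H -> H}) (A : R) (x : H).
Hypothesis A1 : 1 <= A.
Hypothesis T_le : forall n y, nm (iter n T y) <= A * nm y.
Hypothesis x_le : forall n, nm (iter n T x) <= A.

Let A0 : 0 < A. Proof. exact: lt_le_trans A1. Qed.

(** Increments over [n] steps are small relative to the values, once a proportion [d] of the indices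
    is dropped. The witnesses may depend on [N], since increments near [N] are compared with the
    value at [p]. *)
Definition slow_gaps (a : nat -> nat) : Prop :=
  forall (n : nat) (e d : R), 0 < e -> 0 < d -> exists N0, forall N, (N0 <= N)%N ->
  exists p J r : nat, [/\ (p <= N)%N, p%:R <= d * N%:R, (0 < J)%N,
    r%:R <= e * J%:R &
    forall i k, (p <= i < N)%N -> (k < n)%N ->
      (J <= a i)%N /\ (a (i + k)%N <= a i + r)%N].

Lemma negligible_vdc (a : nat -> nat) :
  (forall i j, (i <= j)%N -> (a i <= a j)%N) -> slow_gaps a ->
  (forall h, (0 < h)%N -> negligible T x (fun i => a (i + h) - a i)%N) ->
  negligible T x a.
Proof.
move=> amono agap adiff e e0.
(* In units of [(N n)^2], the diagonal, the differences and the passage from [Psi] to [phi]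
   contribute at most [E] each, while [(e / 2)^2] is [25 E]. *)
pose E := e ^+ 2 / 100.
have E0 : 0 < E by rewrite divr_gt0 // exprn_gt0.
have [n0 n0P] := nat_ge (2 * A ^+ 5 / E).
pose n := n0.+1; have {n0P} nP := n0P n (leqnSn n0).
have nR : (0 : R) < n%:R by rewrite ltr0n.
pose del := E / (4 * A ^+ 4).
have del0 : 0 < del by rewrite divr_gt0 ?mulr_gt0 ?exprn_gt0.
pose ep := E / (4 * A ^+ 4).
have d0 : 0 < e / (4 * A) by rewrite divr_gt0 ?mulr_gt0.
have [N1 N1P] := agap n ep (e / (4 * A)) del0 d0.
have [|N2 N2P] := @common_threshold (fun h N => (0 < h)%N ->
    forall c : nat -> C, (forall i, cm (c i) <= 1) ->
    nm (\sum_(i < N) c i *: iter (a (i + h) - a i)%N T x) <= N%:R * del) n.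
  move=> [|h] _; first by exists 0%N.
  have [N0 N0P] := adiff h.+1 isT _ del0.
  by exists N0 => N NN _; apply: N0P.
have [N3 N3P] := nat_ge (n%:R * (2 * A) / (e / 4)).
exists (maxn (maxn N1 N2) (maxn N3 n)) => N.
rewrite !geq_max => /andP[/andP[h1 h2] /andP[h3 h4]] c c1.
have [p [J [r [pN pd J0 rJ aP]]]] := N1P _ h1.
have JR : (0 : R) < J%:R by rewrite ltr0n.
have NE : N = (p + (N - p))%N by rewrite subnKC.
have := split_head x_le a p (N - p) c1; rewrite -NE => /le_trans; apply.
set N' := (N - p)%N in NE *.
have N'N : (N'%:R : R) <= N%:R by rewrite ler_nat leq_subr.
(* Trivial bound on the diagonal; off it, negligibility of the differences with step [j - k]. The 2
   pays for padding, which lengthens the sum to [N + k <= 2 * N] terms. *)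
pose b (j k : nat) : R := if j == k then N%:R * A ^+ 3 else N%:R * (A ^+ 2 * (2 * del)).
apply: (@le_trans _ _ (p%:R * A + (n%:R * (2 * A) + N%:R * (e / 2)))); last first.
  have := N3P _ h3; rewrite ler_pdivrMr ?divr_gt0 //.
  have : p%:R * A <= N%:R * (e / 4).
    have -> : N%:R * (e / 4) = e / (4 * A) * N%:R * A by field; rewrite gt_eqF.
    by rewrite ler_pM2r.
  lra.
rewrite lerD2l.
have inN i : (i < N')%N -> (p <= p + i < N)%N.
  by move=> iN'; rewrite leq_addr NE ltn_add2l.
apply: (@van_der_corput _ _ _ ip_norm T A x T_le x_le N' n J r
  (fun i => a (p + i)%N) (fun i => c (p + i)%N) b) => //=.
- by move=> i /inN iN; case: (aP _ 0%N iN).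
- by move=> i i' ii' _; rewrite amono // leq_add2l.
- by move=> i k /inN iN kn; rewrite addnA; case: (aP _ k iN kn).
- move=> j k kj jn.
  apply: le_trans (cm_sum_phi ip_norm T_le x_le J N' (fun i => c (p + (i + j))%N *
    (c (p + (i + k))%N)^*) (fun i => a (p + (i + j))%N - a (p + (i + k))%N)%N) _.
  have w1 i : cm (c (p + (i + j))%N * (c (p + (i + k))%N)^*) <= 1.
    by rewrite cmM cmJ -[leRHS]mul1r; apply: ler_pM; rewrite ?cm_ge0.
  have [jk|jk] := eqVneq j k.
    rewrite /b jk eqxx (_ : N%:R * A ^+ 3 = A ^+ 2 * (N%:R * A)); last by ring.
    apply: ler_wpM2l; first exact: sqr_ge0.
    apply: (@le_trans _ _ (N'%:R * A)); last by rewrite ler_pM2r.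
    apply: (@nm_sum_le _ _ N' (fun i => c (p + (i + k))%N * (c (p + (i + k))%N)^* *:
      iter (a (p + (i + k))%N - a (p + (i + k))%N)%N T x)) => i _.
    apply: (nm_term_le x_le (fun i => a (p + (i + k))%N - a (p + (i + k))%N)%N i
      (c := fun i => c (p + (i + k))%N * (c (p + (i + k))%N)^*)).
    by move=> i'; rewrite cmM cmJ -[leRHS]mul1r; apply: ler_pM; rewrite ?cm_ge0.
  rewrite /b (negPf jk) mulrCA; apply: ler_wpM2l; first exact: sqr_ge0.
  pose u i := iter (a (i + (j - k)) - a i)%N T x.
  have -> : \sum_(i < N') c (p + (i + j))%N * (c (p + (i + k))%N)^* *:
      iter (a (p + (i + j))%N - a (p + (i + k))%N)%N T x =
    \sum_(i < N') c (p + (i + j))%N * (c (p + (i + k))%N)^* *: u (p + k + i)%N.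
    apply: eq_bigr => i _; rewrite /u.
    have -> : (p + k + i + (j - k) = p + (i + j))%N.
      by rewrite -!addnA [(k + _)%N]addnCA subnKC.
    by rewrite -[(p + k + i)%N]addnA [(k + i)%N]addnC.
  rewrite (pad_head (fun i => c (p + (i + j))%N * (c (p + (i + k))%N)^*) u).
  have jk0 : (0 < j - k)%N by rewrite subn_gt0 ltn_neqAle eq_sym jk.
  have jkn : (j - k < n)%N by rewrite (leq_ltn_trans (leq_subr _ _)).
  have hN : (N2 <= p + k + N')%N by apply: leq_trans h2 _; rewrite NE addnAC leq_addr.
  have := N2P _ hN _ jkn jk0 (fun i => if (i < p + k)%N then 0 else
    c (p + (i - (p + k) + j))%N * (c (p + (i - (p + k) + k))%N)^*).
  move=> /(_ _)/le_trans; apply.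
    by move=> i; case: ifP; rewrite ?cm0.
  have -> : N%:R * (2 * del) = (N%:R + N%:R) * del by ring.
  rewrite ler_pM2r // -natrD ler_nat addnAC -NE leq_add2l.
  by rewrite (leq_trans (leq_trans kj (ltnW jn))).
- by rewrite mulr_ge0 // divr_ge0 // ltW.
pose rho := r%:R * (2 * A ^+ 2) / J%:R.
have rho_le : rho <= ep * (2 * A ^+ 2).
  by rewrite /rho mulrAC ler_pM2r ?mulr_gt0 ?exprn_gt0 // ler_pdivrMr.
pose w := N%:R * (A ^+ 2 * (2 * del) + ep * (2 * A ^+ 2)).
have w0 : 0 <= w.
  by rewrite /w; do ?[by []|exact: ltW|apply: addr_ge0|apply: mulr_ge0|apply: exprn_ge0].
have bs : \sum_(j < n) \sum_(k < n | (k <= j)%N) (b j k + N'%:R * rho) <=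
    n%:R * (N%:R * A ^+ 3) + n%:R ^+ 2 * w.
  apply: (@le_trans _ _ (\sum_(j < n) (N%:R * A ^+ 3 +
      \sum_(k < n | (k <= j)%N) w))); last first.
    rewrite big_split /=; apply: lerD; last exact: tri_sum_const.
    exact: (@sum_le_const _ _ (fun=> N%:R * A ^+ 3)).
  apply: ler_sum => j _; rewrite (bigD1 j) //= [X in _ <= _ + X](bigD1 j) //= addrA.
  apply: lerD.
    rewrite /b eqxx lerD2l /w mulrDr -[leLHS]add0r; apply: lerD.
      by do ?[by []|exact: ltW|apply: mulr_ge0|apply: exprn_ge0].
    apply: ler_pM => //; rewrite /rho.
    by do ?[by []|exact: ltW|apply: mulr_ge0|apply: exprn_ge0|rewrite invr_ge0].
  apply: ler_sum => k /andP[kj kjn]; rewrite /b eq_sym.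
  have -> : (k == j :> nat) = false by apply/negbTE; apply: contra kjn => /eqP/val_inj ->.
  rewrite /w mulrDr lerD2l; apply: ler_pM => //; rewrite /rho.
  by do ?[by []|exact: ltW|apply: mulr_ge0|apply: exprn_ge0|rewrite invr_ge0].
apply: (@le_trans _ _ (N%:R * (A ^+ 2 * (2 * (n%:R * (N%:R * A ^+ 3) + n%:R ^+ 2 * w))))).
  apply: (@le_trans _ _ (N'%:R * (A ^+ 2 * (2 * (n%:R * (N%:R * A ^+ 3) + n%:R ^+ 2 * w))))).
    apply: ler_wpM2l => //; apply: ler_wpM2l; first exact: sqr_ge0.
    by apply: ler_wpM2l.
  apply: ler_wpM2r => //.
  by do ?[by []|exact: ltW|apply: mulr_ge0|apply: addr_ge0|apply: exprn_ge0].
have -> : N%:R * (A ^+ 2 * (2 * (n%:R * (N%:R * A ^+ 3) + n%:R ^+ 2 * w))) =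
  (N%:R * n%:R) ^+ 2 * (2 * A ^+ 5 / n%:R + 2 * E).
  by rewrite /w /del /ep; field; rewrite !gt_eqF.
have -> : (n%:R * (N%:R * (e / 2))) ^+ 2 = (N%:R * n%:R) ^+ 2 * (25 * E).
  by rewrite /E; field.
apply: ler_wpM2l; first exact: sqr_ge0.
have : 2 * A ^+ 5 / n%:R <= E.
  by rewrite ler_pdivrMr // [leRHS]mulrC -ler_pdivrMr.
by move: (_ / n%:R) => v; lra.
Qed.

End VanDerCorputReduction.

(** * Quantitative growth in the classes P *)

Section Growth.
Variable R : realType.
Implicit Types (F : nat -> R -> R) (C s t : R) (m k : nat).

(* [F 0, F 1, ...] are the successive derivatives of a function of class
   [P_(m+1)], translated so that the eventual conditions hold on [[0, +oo[]. *)
Definition growth m F C : Prop :=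
  [/\ 0 < C,
    forall k t, (k <= m)%N -> 0 <= t -> is_derive t 1 (F k) (F k.+1 t),
    forall k t, (k <= m.+1)%N -> 0 <= t -> 0 < F k t,
    forall t, 0 <= t -> F m t <= C * (1 + t) * F m.+1 t &
    forall s t, 0 <= t -> t <= s -> F m.+1 s <= C * F m.+1 t].

Lemma mean_value (f df : R -> R) s t : s <= t ->
  (forall u, s <= u <= t -> is_derive u 1 f (df u)) ->
  exists2 u, s <= u <= t & f t - f s = df u * (t - s).
Proof.
move=> st fdf; have [||u ust E] := @MVT_segment R f df s t st.
- by move=> u /itvP ust; apply: fdf; rewrite !ust.
- apply: derivable_within_continuous => u; rewrite in_itv /= => ust.
  by have := fdf u ust; apply: @ex_derive.
by exists u => //; move: ust; rewrite in_itv.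
Qed.

Lemma is_derive_affine (f df : R -> R) a b t :
  is_derive (a * t + b) 1 f (df (a * t + b)) ->
  is_derive t 1 (fun u => f (a * u + b)) (a * df (a * t + b)).
Proof.
move=> fdf; rewrite mulrC.
have g : is_derive t 1 (fun u : R => a * u + b) a.
  have -> : (fun u : R => a * u + b) = (a \*: (id : R -> R)) + cst b by [].
  by apply: is_derive_eq; rewrite addr0 [_ *: _]mulr1.
exact: (is_derive1_comp (g := fun u => a * u + b) fdf g).
Qed.

Section Properties.
Variables (m : nat) (F : nat -> R -> R) (C : R).
Hypothesis FG : growth m F C.

Let C0 : 0 < C. Proof. by case: FG. Qed.
Let F0 k t : (k <= m.+1)%N -> 0 <= t -> 0 < F k t.
Proof. by case: FG => _ _ h _ _; apply: h. Qed.

Lemma growth_mvt k s t : (k <= m)%N -> 0 <= s -> s <= t ->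
  exists2 u, s <= u <= t & F k t - F k s = F k.+1 u * (t - s).
Proof.
case: FG => _ dF _ _ _ km s0 st; apply: mean_value => // u /andP[su _].
by apply: dF => //; apply: le_trans su.
Qed.

Lemma growth_mono k s t : (k <= m)%N -> 0 <= s -> s <= t -> F k s <= F k t.
Proof.
move=> km s0 st; have [u /andP[su _] E] := growth_mvt km s0 st.
by rewrite -subr_ge0 E mulr_ge0 ?subr_ge0 // ltW // F0 // (le_trans s0).
Qed.

(** [F m t - F m 0] is [t] times an earlier value of [F m.+1], which is at least [F m.+1 t / C]; the
    positive [F m 0] supplies the 1 of [1 + t]. With the fourth condition of [growth], [F m t] and
    [(1 + t) * F m.+1 t] are thus comparable. *)
Lemma growth_top : exists2 q, 0 < q &
  forall t, 0 <= t -> q * (1 + t) * F m.+1 t <= F m t.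
Proof.
have a0 : 0 < F m 0 by apply: F0.
have b0 : 0 < F m.+1 0 by apply: F0.
case: FG => _ _ _ _ dec.
exists (Num.min (F m 0 / F m.+1 0) 1 / C) => [|t t0].
  by rewrite divr_gt0 // lt_min divr_gt0 // ltr01.
set mu := Num.min _ _.
have mu0 : 0 <= mu by rewrite le_min ler01 andbT divr_ge0 // ltW.
have mu1 : mu <= 1 by rewrite ge_min lexx orbT.
have mua : mu <= F m 0 / F m.+1 0 by rewrite ge_min lexx.
have [u /andP[u0 ut] E] := growth_mvt (leqnn m) (lexx 0) t0.
have d1 : F m.+1 t <= C * F m.+1 u by apply: dec.
have d2 : F m.+1 t <= C * F m.+1 0 by apply: dec.
have v0 : 0 < F m.+1 t by apply: F0.
have h1 : mu / C * F m.+1 t <= F m 0.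
  rewrite mulrAC ler_pdivrMr //.
  apply: (@le_trans _ _ (F m 0 / F m.+1 0 * (C * F m.+1 0))).
    by apply: ler_pM => //; exact: ltW.
  by rewrite mulrCA divfK ?gt_eqF // mulrC.
have h2 : mu / C * F m.+1 t * t <= F m t - F m 0.
  rewrite E subr0; apply: ler_wpM2r => //.
  rewrite mulrAC ler_pdivrMr // [leRHS]mulrC -[leRHS]mul1r; apply: ler_pM => //.
  exact: ltW.
by lra.
Qed.

(** Descending induction on [k]. At the top, [F m.+1] is almost decreasing. Below,
    [K * D * F i u - F i (K * u)] has nonnegative derivative, and the summand 1 in the new constant
    pays for its value at 0. *)
Lemma growth_doubling k K : (k <= m.+1)%N -> 1 <= K ->
  exists2 D, 0 < D & forall t, 0 <= t -> F k (K * t) <= D * F k t.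
Proof.
move=> km K1; have K0 : 0 < K by apply: lt_le_trans K1.
have le_K t : 0 <= t -> t <= K * t by move=> t0; rewrite ler_peMl.
rewrite -(subKn km); elim: (m.+1 - k)%N (leq_subr k m.+1) => [|j IH] jm.
  exists C => // t t0; rewrite subn0; case: FG => _ _ _ _; apply => //.
  exact: le_K.
have [|D D0 DP] := IH; first exact: ltnW.
set i := (m.+1 - j.+1)%N in DP *.
have iS : (m.+1 - j)%N = i.+1 by rewrite /i -subSn // subSS.
rewrite iS in DP; have im : (i <= m)%N by rewrite /i subSS leq_subr.
exists (K * D + 1) => [|t t0]; first by rewrite addr_gt0 ?mulr_gt0.
have K0t u : 0 <= u -> 0 <= K * u by move=> u0; rewrite mulr_ge0 // ltW.
pose h u := K * D * F i u - F i (K * u + 0).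
have [|u /andP[u0 _] E] := @mean_value h
    (fun u => K * D * F i.+1 u - K * F i.+1 (K * u + 0)) 0 t t0.
  move=> u /andP[u0 _]; case: FG => _ dF _ _ _.
  have d1 := dF i u im u0.
  have d2 := @is_derive_affine (F i) (F i.+1) K 0 u (dF i (K * u + 0) im _).
  have {}d2 : is_derive u 1 (fun v => F i (K * v + 0)) (K * F i.+1 (K * u + 0)).
    by apply: d2; rewrite addr0 K0t.
  have -> : h = (K * D) *: F i - (fun v => F i (K * v + 0)) by [].
  exact: is_deriveB.
have E0 : 0 <= h t - h 0.
  rewrite E subr0 mulr_ge0 // addr0 -mulrA -mulrBr mulr_ge0 ?(ltW K0) //.
  by rewrite subr_ge0 DP.
have f0 : F i 0 <= F i t by apply: growth_mono.
have p0 : 0 < F i 0 by apply: F0 => //; apply: leqW.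
move: E0; rewrite /h mulr0 !addr0.
have : 0 <= K * D * F i 0 by rewrite !mulr_ge0 // ltW.
lra.
Qed.

(** From [t] to [2 * t + 1] the gain is at least [r]: there [F m.+1 u] is at least
    [F m 0 / (C * (1 + u))], and [1 + u <= 2 * (t + 1)]. *)
Lemma growth_bottom_unbounded : exists2 r, 0 < r &
  forall j : nat, exists2 t, 0 <= t & j%:R * r <= F m t.
Proof.
have a0 : 0 < F m 0 by apply: F0.
exists (F m 0 / (2 * C)) => [|j]; first by rewrite divr_gt0 ?mulr_gt0.
elim: j => [|j [t t0 IH]]; first by exists 0; rewrite ?mul0r // ltW.
have t2 : t <= 2 * t + 1 by lra.
exists (2 * t + 1); first by lra.
have [u /andP[tu ut] E] := growth_mvt (leqnn m) t0 t2.
have u0 := le_trans t0 tu.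
case: FG => _ _ _ /(_ u u0) h _.
have b0 : 0 < F m.+1 u by apply: F0.
have mn : F m 0 <= F m u by apply: growth_mono.
rewrite -natr1 mulrDl mul1r.
have : F m 0 / (2 * C) <= F m.+1 u * (2 * t + 1 - t).
  rewrite ler_pdivrMr ?mulr_gt0 //; apply: le_trans mn (le_trans h _).
  have -> : F m.+1 u * (2 * t + 1 - t) * (2 * C) = C * (2 * t + 2) * F m.+1 u by ring.
  rewrite ler_pM2r // ler_pM2l //; lra.
lra.
Qed.

Lemma growth_unbounded B : exists2 t1, 0 <= t1 & forall t, t1 <= t -> B <= F 0 t.
Proof.
suff [t1 t10 Bt] : exists2 t1, 0 <= t1 & B <= F 0 t1.
  exists t1 => // t t1t; apply: le_trans Bt _; exact: growth_mono.
(* For [m = 0] the derivative may tend to 0 and growth may be only logarithmic; otherwise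
   [F 1 >= F 1 0 > 0] gives linear growth. *)
have [m0|m0] := posnP m.
  have [r r0 rP] := growth_bottom_unbounded; rewrite m0 in rP.
  have [j jP] := nat_ge (B / r).
  have [t t0 tP] := rP j; exists t => //; apply: le_trans tP.
  by rewrite -ler_pdivrMr // jP.
have a0 : 0 < F 1 0 by apply: F0.
exists (`|B| / F 1 0); first by rewrite divr_ge0 // ltW.
set t := _ / _; have t0 : 0 <= t by rewrite divr_ge0 // ltW.
have [u /andP[u0 _] E] := growth_mvt (leq0n m) (lexx 0) t0.
have mn : F 1 0 <= F 1 u by apply: growth_mono.
have b0 : 0 < F 0 0 by apply: F0.
have : F 1 0 * t <= F 1 u * (t - 0) by rewrite subr0 ler_wpM2r.
rewrite {1}/t mulrCA divff ?gt_eqF // mulr1 -E.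
have := ler_norm B; lra.
Qed.

End Properties.

(** Each difference is [h] times the next derivative at an intermediate point, so the conditions
    reduce to comparing values of [F m.+1] and [F m.+2] across [[t, t + h]], in both directions for
    [F m.+2]. *)
Lemma growth_diff m F C h : growth m.+1 F C -> 0 < h ->
  exists C', growth m (fun k t => F k (t + h) - F k t) C'.
Proof.
move=> FG h0; have [q q0 qP] := growth_top FG.
have := FG => -[C0 dF F0 bot dec].
have step k t : (k <= m.+1)%N -> 0 <= t -> exists2 u, t <= u <= t + h &
    F k (t + h) - F k t = F k.+1 u * h.
  move=> km t0; have th : t <= t + h by rewrite lerDl ltW.
  have [u ut ->] := growth_mvt FG km t0 th; exists u => //.
  by rewrite addrAC subrr add0r.
pose D := C * (1 + h) / q.
have D0 : 0 < D by rewrite divr_gt0 // mulr_gt0 // addr_gt0.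
(* An almost decreasing function could still drop abruptly; comparing it with the increasing
   [F m.+1] at [t] and at [t + h] excludes this. *)
have back t : 0 <= t -> F m.+2 t <= D * F m.+2 (t + h).
  move=> t0; have th0 : 0 <= t + h by rewrite addr_ge0 // ltW.
  have := qP t t0; have := bot _ th0.
  have : F m.+1 t <= F m.+1 (t + h) by apply: (growth_mono FG) => //; rewrite lerDl ltW.
  have v0 : 0 < F m.+2 (t + h) by apply: F0.
  move=> h1 h2 h3; have h4 := le_trans h3 (le_trans h1 h2).
  have t1 : 0 < q * (1 + t) by rewrite mulr_gt0 // ltr_wpDr.
  rewrite -(ler_pM2l t1); apply: le_trans h4 _.
  have -> : q * (1 + t) * (D * F m.+2 (t + h)) =
      C * ((1 + t) * (1 + h)) * F m.+2 (t + h) by rewrite /D; field; rewrite gt_eqF.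
  rewrite ler_pM2r // ler_pM2l //.
  have : 0 <= t * h by rewrite mulr_ge0 // ltW.
  lra.
pose C1 := C ^+ 2 * (1 + h); pose C2 := C ^+ 2 * D.
have C10 : 0 < C1 by rewrite mulr_gt0 ?exprn_gt0 // addr_gt0.
have C20 : 0 < C2 by rewrite mulr_gt0 ?exprn_gt0.
exists (C1 + C2); split.
- exact: addr_gt0.
- move=> k t km t0; have th0 : 0 <= t + h by rewrite addr_ge0 // ltW.
  have d1 := dF k t (leqW km) t0.
  have := @is_derive_affine (F k) (F k.+1) 1 h t.
  rewrite !mul1r => /(_ (dF k _ (leqW km) th0)) d2.
  have {}d2 : is_derive t 1 (fun u => F k (u + h)) (F k.+1 (t + h)).
    by move: d2; congr is_derive; apply/funext => u; rewrite mul1r.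
  have -> : (fun t => F k (t + h) - F k t) = (fun u => F k (u + h)) - F k by [].
  exact: is_deriveB.
- move=> k t km t0; have [u /andP[tu _] ->] := step k t km t0.
  by rewrite mulr_gt0 // F0 // (le_trans t0).
- move=> t t0; have [u /andP[tu uth] ->] := step m t (leqnSn m) t0.
  have [v /andP[tv vth] ->] := step m.+1 t (leqnn _) t0.
  have u0 := le_trans t0 tu; have v0 := le_trans t0 tv.
  have th0 : 0 <= t + h by rewrite addr_ge0 // ltW.
  have h1 : F m.+1 u <= F m.+1 (t + h) by apply: (growth_mono FG).
  have h2 := bot _ th0.
  have h3 := dec _ _ v0 vth.
  have p0 : 0 < F m.+2 v by apply: F0.
  have t1 : 0 < 1 + t by rewrite ltr_wpDr.
  rewrite mulrA ler_pM2r //.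
  apply: (@le_trans _ _ (C1 * (1 + t) * F m.+2 v)); last first.
    by rewrite ler_pM2r // ler_pM2r // lerDl ltW.
  apply: le_trans h1 (le_trans h2 _).
  apply: (@le_trans _ _ (C * (1 + (t + h)) * (C * F m.+2 v))).
    by apply: ler_wpM2l => //; rewrite mulr_ge0 ?(ltW C0) // addr_ge0.
  have -> : C * (1 + (t + h)) * (C * F m.+2 v) = C ^+ 2 * (1 + (t + h)) * F m.+2 v by ring.
  rewrite ler_pM2r // /C1 -mulrA ler_pM2l ?exprn_gt0 //.
  have : 0 <= t * h by rewrite mulr_ge0 // ltW.
  lra.
- move=> s t t0 ts; have s0 := le_trans t0 ts.
  have [u /andP[su _] ->] := step m.+1 s (leqnn _) s0.
  have [v /andP[tv vth] ->] := step m.+1 t (leqnn _) t0.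
  have v0 := le_trans t0 tv.
  have p0 : 0 < F m.+2 v by apply: F0.
  rewrite mulrA ler_pM2r //.
  apply: (@le_trans _ _ (C2 * F m.+2 v)); last by rewrite ler_pM2r // lerDr ltW.
  apply: le_trans (dec _ _ t0 (le_trans ts su)) _.
  have -> : C2 * F m.+2 v = C * (D * (C * F m.+2 v)) by rewrite /C2; ring.
  rewrite ler_pM2l //; apply: le_trans (back t t0) _.
  by apply: ler_wpM2l; [exact: ltW | exact: dec].
Qed.

(** [F 1] is increasing, so before [2N] it is at most its mean over [[2N, 4N]], hence at most
    [F 0 (4N) / (2N)]. Since [p >= del * N / 2], [4N <= K * p], and doubling bounds this by
    [D * F 0 p / (2N)]. *)
Lemma growth_slow_gaps m F C : growth m.+1 F C ->
  slow_gaps R (fun i => Num.truncn (F 0%N i%:R)).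
Proof.
move=> FG n e d e0 d0.
have := FG => -[C0 dF F0 bot dec].
pose del := Num.min d 1.
have del0 : 0 < del by rewrite lt_min d0 ltr01.
have del1 : del <= 1 by rewrite ge_min lexx orbT.
have deld : del <= d by rewrite ge_min lexx.
pose K := 8 / del.
have K1 : 1 <= K by rewrite ler_pdivlMr // mul1r; lra.
have K0 : 0 < K by apply: lt_le_trans K1.
have [D D0 DP] := growth_doubling FG (leq0n _) K1.
(* This lower bound on [F 0 p] gives [e / 4 * F 0 p + 1 <= e * (F 0 p - 1)], whence [r <= e * J]
   despite the integer parts. *)
have [t1 t10 t1P] := growth_unbounded FG ((8 + 4 * e) / (3 * e) + 1).
have [N1 N1P] := nat_ge (2 * (t1 + 1) / del).
have [N2 N2P] := nat_ge (2 * n%:R * D / e).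
exists (maxn n (maxn N1 N2)) => N; rewrite !geq_max => /and3P[hn /N1P h1 /N2P h2].
pose p := Num.truncn (del * N%:R).
have NR : (0 : R) <= N%:R by [].
have dN0 : 0 <= del * N%:R by rewrite mulr_ge0 // ltW.
have /andP[p1 p2] := truncn_itv dN0; rewrite -/p -natr1 in p1 p2.
have pbig : t1 <= p%:R /\ del * N%:R <= 2 * p%:R.
  by move: h1; rewrite ler_pdivrMr // [_ * del]mulrC => h1; split; lra.
have N0 : (0 : R) < N%:R.
  apply: lt_le_trans h1; rewrite divr_gt0 // mulr_gt0 //; lra.
case: pbig => pt1 pN.
have pos t : 0 <= t -> 0 < F 0%N t by apply: F0.
have fp := t1P _ pt1.
have pp : (0 : R) <= p%:R by [].
have /andP[J1 J2] := truncn_itv (ltW (pos _ pp)).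
pose J := Num.truncn (F 0%N p%:R); rewrite -/J -natr1 in J1 J2.
pose gap := n%:R * D * F 0%N p%:R / (2 * N%:R).
have gap0 : 0 <= gap.
  by rewrite divr_ge0 ?mulr_ge0 // ?(ltW D0) // ltW // pos.
have /andP[g1 g2] := truncn_itv gap0.
pose r := (Num.truncn gap).+1.
have gapr : gap < r%:R by [].
have fp2 : 1 + 8 / (3 * e) <= F 0%N p%:R.
  apply: le_trans fp; rewrite -subr_ge0.
  have -> : (8 + 4 * e) / (3 * e) + 1 - (1 + 8 / (3 * e)) = 4 / 3.
    by field; rewrite gt_eqF.
  by [].
exists p, J, r; split.
- rewrite -(ler_nat R); apply: le_trans p1 _; rewrite -[leRHS]mul1r.
  exact: ler_wpM2r.
- by apply: le_trans p1 _; apply: ler_wpM2r.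
- rewrite -(ltr_nat R); have : 0 < 8 / (3 * e) by rewrite divr_gt0 ?mulr_gt0.
  lra.
- have : gap <= e / 4 * F 0%N p%:R.
    rewrite /gap mulrAC; apply: ler_wpM2r; first by rewrite ltW // pos.
    rewrite ler_pdivrMr ?mulr_gt0 //.
    move: h2; rewrite ler_pdivrMr //; lra.
  have : (8 + 4 * e) / (3 * e) * (3 * e) <= (F 0%N p%:R - 1) * (3 * e).
    by rewrite ler_pM2r ?mulr_gt0 //; lra.
  rewrite divfK ?gt_eqF ?mulr_gt0 // /r -natr1.
  have : e * (F 0%N p%:R - 1) <= e * J%:R by rewrite ler_pM2l //; lra.
  lra.
move=> i k /andP[pi iN] kn.
have iR : (0 : R) <= i%:R by [].
have mono0 s t : 0 <= s -> s <= t -> F 0%N s <= F 0%N t.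
  by move=> s0 st; apply: (growth_mono FG).
have mono1 s t : 0 <= s -> s <= t -> F 1%N s <= F 1%N t.
  by move=> s0 st; apply: (growth_mono FG).
split; first by apply: le_truncn; apply: mono0 => //; rewrite ler_nat.
have i2N : (i + k <= 2 * N)%N by rewrite mul2n -addnn leq_add // ltnW // (leq_trans kn).
have iik : (i%:R : R) <= (i + k)%:R by rewrite ler_nat leq_addr.
have [u /andP[u1 u2] E] := growth_mvt FG (leq0n _) iR iik.
have NN2 : (0 : R) <= (2 * N)%:R by [].
have N24 : ((2 * N)%:R : R) <= (4 * N)%:R by rewrite ler_nat leq_mul2r orbT.
have [v /andP[v1 v2] E2] := growth_mvt FG (leq0n _) NN2 N24.
have u2N : u <= (2 * N)%:R by apply: le_trans u2 _; rewrite ler_nat.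
have m1 : F 1%N u <= F 1%N v.
  by apply: mono1; [apply: le_trans u1 | apply: le_trans v1].
have m2 : F 1%N v * (2 * N%:R) <= D * F 0%N p%:R.
  have -> : 2 * N%:R = (4 * N)%:R - (2 * N)%:R :> R by rewrite !natrM; ring.
  rewrite -E2; apply: (@le_trans _ _ (F 0%N (4 * N)%:R)).
    by rewrite gerBl ltW // pos.
  apply: le_trans (DP _ pp); apply: mono0 => //.
  rewrite natrM /K mulrAC ler_pdivlMr // ; lra.
have m3 : F 0%N (i + k)%:R - F 0%N i%:R <= gap.
  rewrite E /gap ler_pdivlMr ?mulr_gt0 //.
  have -> : (i + k)%:R - i%:R = k%:R :> R by rewrite natrD addrAC subrr add0r.
  have vp : 0 < F 1%N v by apply: F0 => //; apply: le_trans v1.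
  apply: (@le_trans _ _ (F 1%N v * n%:R * (2 * N%:R))).
    apply: ler_wpM2r; first by rewrite mulr_ge0.
    apply: ler_pM => //; first by rewrite ltW // F0 // (le_trans iR).
    by rewrite ler_nat ltnW.
  by rewrite mulrAC [leRHS](_ : _ = D * F 0%N p%:R * n%:R) ?ler_wpM2r //; ring.
have /andP[a1 a2] := truncn_itv (ltW (pos _ iR)).
rewrite -ltnS truncn_lt_nat ?(ltW (pos _ _)) //.
rewrite -addSn [X in _ < X]natrD.
apply: (@le_lt_trans _ _ (F 0%N i%:R + gap)); first by rewrite addrC -lerBlDr.
exact: ltrD.
Qed.

End Growth.

Lemma truncn_sub (R : realType) (u v : R) : 0 <= u -> u <= v ->
  (Num.truncn v - Num.truncn u = Num.truncn (v - u) \/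
   Num.truncn v - Num.truncn u = (Num.truncn (v - u)).+1)%N.
Proof.
move=> u0 uv; have v0 := le_trans u0 uv.
have w0 : 0 <= v - u by rewrite subr_ge0.
have /andP[] := truncn_itv u0; have /andP[] := truncn_itv v0.
have /andP[] := truncn_itv w0.
move: (Num.truncn v) (Num.truncn u) (Num.truncn _) => q p r.
rewrite -!natr1 => r1 r2 q1 q2 p1 p2.
have h1 : (p + r < q.+1)%N by rewrite -(ltr_nat R) natrD -natr1; lra.
have h2 : (q < p + r + 2)%N by rewrite -(ltr_nat R) !natrD; lra.
lia.
Qed.

(** * Integer parts of functions of class P *)

Section GrowthNegligible.
Variables (R : realType) (H : completeNormedModType R[i]).
Local Notation C := R[i].
Variable ip : {dot H for Num.conj}.
Hypothesis ip_norm : forall x : H, ip x x = `|x| ^+ 2.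
Variables (T : {linear H -> H}) (A : R) (x : H).
Hypothesis A1 : 1 <= A.
Hypothesis T_le : forall n y, nm (iter n T y) <= A * nm y.
Hypothesis x_le : forall n, nm (iter n T x) <= A.
Hypothesis T_spec : forall (z : C) y, cm z = 1 -> T y = z *: y -> y = 0.

(* Each value of [truncn (F 0)] below [F 0 N] is taken at most [O(1 / F 1 N)]
   times, and [F 0 N = O(N F 1 N)]. *)
Lemma growth0_negligible F (B : R) : growth 0 F B ->
  negligible T x (fun i => Num.truncn (F 0%N i%:R)).
Proof.
move=> FG e e0; have := FG => -[B0 dF F0 bot dec].
have f0 : 0 < F 0%N 0 by apply: F0.
have f1 : 0 < F 1%N 0 by apply: F0.
(* Multiplicity [W] times number of values [K]: the factor [F 1 N] cancels, leaving at most
   [D * (1 + N)]. *)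
pose D := (B + B * F 1%N 0) * ((1 + (F 0%N 0)^-1) * B).
have D0 : 0 < D.
  by rewrite mulr_gt0 ?addr_gt0 ?mulr_gt0 // addr_gt0 // invr_gt0.
have e'0 : 0 < e / (2 * D) by rewrite divr_gt0 // mulr_gt0.
have [K0 K0P] := negligible_id ip_norm A1 T_le x_le T_spec e'0.
have [t1 t10 t1P] := growth_unbounded FG K0%:R.
have [N1 N1P] := nat_ge t1.
exists (maxn 1 N1) => N; rewrite geq_max => /andP[N0 /N1P Nt1] c c1.
have NR : (0 : R) <= N%:R by [].
pose a i := Num.truncn (F 0%N i%:R).
have mono0 s t : 0 <= s -> s <= t -> F 0%N s <= F 0%N t.
  by move=> s0 st; apply: (growth_mono FG).
have amono i j : (i <= j)%N -> (a i <= a j)%N.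
  by move=> ij; apply: le_truncn; apply: mono0 => //; rewrite ler_nat.
pose K := (a N).+1.
pose y := F 1%N N%:R; have y0 : 0 < y by apply: F0.
(* As [y <= B * F 1 0], the second term absorbs the 1 in [L.+1]. *)
pose W := (B + B * F 1%N 0) / y.
have W0 : 0 < W by rewrite divr_gt0 // addr_gt0 // mulr_gt0.
pose w k := \sum_(i < N | a i == k) c i.
have By0 : 0 <= B / y by rewrite divr_ge0 ?ltW.
pose L := Num.truncn (B / y).
have LW : L.+1%:R <= W.
  have /andP[l1 _] := truncn_itv By0.
  rewrite -natr1 /W mulrDl; apply: lerD l1 _.
  by rewrite ler_pdivlMr // mul1r; apply: dec.
(* Where the integer part is constant, [F 0] varies by less than 1 while its derivative is at least
   [y / B]; so these indices lie within [L] of the least one. *)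
have card_le k : (#|[pred i : 'I_N | a i == k]| <= L.+1)%N.
  case: (pickP [pred i : 'I_N | a i == k]) => [i1 i1k|no]; last first.
    by rewrite eq_card0.
  case: (@arg_minnP _ i1 (fun i => a i == k) (fun i => i : nat) i1k) => i0 /eqP i0k imin.
  have close (i : 'I_N) : a i == k -> (i - i0 <= L)%N.
    move=> /eqP ik; have i0i : (i0 <= i)%N by apply: imin; rewrite ik.
    rewrite truncn_ge_nat // ler_pdivlMr // natrB //.
    have i0R : (0 : R) <= i0%:R by [].
    have iiR : (i0%:R : R) <= i%:R by rewrite ler_nat.
    have [u /andP[u1 u2] E] := growth_mvt FG (leqnn 0) i0R iiR.
    have yu : y <= B * F 1%N u.
      apply: dec; first exact: le_trans u1.
      by apply: le_trans u2 _; rewrite ler_nat ltnW.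
    apply: (@le_trans _ _ ((i%:R - i0%:R) * (B * F 1%N u))).
      by apply: ler_wpM2l => //; rewrite subr_ge0.
    rewrite mulrCA [_ * F _ _]mulrC -E -[leRHS]mulr1 ler_pM2l //.
    have /andP[h1 h2] := truncn_itv (ltW (F0 _ _ (isT : 0 <= 1)%N (ler0n R i))).
    have /andP[h3 h4] := truncn_itv (ltW (F0 _ _ (isT : 0 <= 1)%N i0R)).
    move: h2 h3; rewrite -/(a i) -/(a i0) ik i0k -natr1; lra.
  rewrite -[L.+1]card_ord.
  apply: (@leq_card_in _ _ (fun i : 'I_N => inord (i - i0) : 'I_L.+1)) => i j.
  rewrite !inE => ik jk /(congr1 val); rewrite /= !inordK ?ltnS ?close // => E.
  apply: val_inj => /=; rewrite -(subnK (imin _ ik)) -[RHS](subnK (imin _ jk)).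
  by rewrite E.
have wW k : cm (w k) <= W.
  apply: le_trans (cm_sum _ _ _) (le_trans _ LW).
  apply: (@le_trans _ _ (\sum_(i < N | a i == k) 1)).
    by apply: ler_sum => i _; apply: c1.
  by rewrite sumr_const ler_nat; apply: card_le.
have -> : \sum_(i < N) c i *: iter (a i) T x = \sum_(k < K) w k *: iter k T x.
  under [RHS]eq_bigr do rewrite /w scaler_suml.
  rewrite (exchange_big_dep xpredT) //=; apply: eq_bigr => i _.
  have aiK : (a i < K)%N by rewrite ltnS amono // ltnW.
  by rewrite (big_pred1 (Ordinal aiK)) //= => k; rewrite eq_sym.
(* Divided by [W], the grouped weights have modulus at most 1, so [negligible_id] applies with
   length [K]. *)
have -> : \sum_(k < K) w k *: iter k T x =
    rc W *: \sum_(k < K) (rc W^-1 * w k) *: iter k T x.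
  rewrite scaler_sumr; apply: eq_bigr => k _.
  by rewrite scalerA mulrA -rcM mulfV ?gt_eqF // mul1r.
rewrite nmZ cm_rc ger0_norm ?(ltW W0) //.
have fN := t1P _ Nt1.
have K0K : (K0 <= K)%N.
  by rewrite leqW // truncn_ge_nat // ltW // F0.
have c'1 k : cm (rc W^-1 * w k) <= 1.
  rewrite cmM cm_rc ger0_norm ?invr_ge0 ?(ltW W0) //.
  by rewrite ler_pdivrMl // mulr1.
apply: (@le_trans _ _ (W * (K%:R * (e / (2 * D))))).
  by rewrite ler_pM2l //; apply: (K0P K K0K (fun k => rc W^-1 * w k)).
have fN0 : F 0%N 0 <= F 0%N N%:R by apply: mono0.
have /andP[k1 _] := truncn_itv (le_trans (ltW f0) fN0).
have KF : K%:R <= (1 + (F 0%N 0)^-1) * F 0%N N%:R.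
  rewrite mulrDl mul1r -natr1; apply: lerD k1 _.
  by rewrite mulrC ler_pdivlMr // mul1r.
have KB : K%:R <= (1 + (F 0%N 0)^-1) * (B * (1 + N%:R) * y).
  apply: le_trans KF _; apply: ler_wpM2l; last exact: bot.
  by rewrite addr_ge0 // invr_ge0 ltW.
have WK : W * K%:R <= D * (1 + N%:R).
  apply: (@le_trans _ _ (W * ((1 + (F 0%N 0)^-1) * (B * (1 + N%:R) * y)))).
    by rewrite ler_pM2l.
  rewrite le_eqVlt; apply/orP; left; apply/eqP.
  by rewrite /W /D; field; rewrite !gt_eqF.
rewrite mulrA; apply: (@le_trans _ _ (D * (2 * N%:R) * (e / (2 * D)))).
  rewrite ler_pM2r //; apply: le_trans WK _; rewrite ler_pM2l //.
  have : (1 : R) <= N%:R by rewrite ler1n.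
  lra.
rewrite le_eqVlt; apply/orP; left; apply/eqP; field.
by rewrite gt_eqF.
Qed.

Lemma growth_negligible m F (B : R) : growth m F B ->
  negligible T x (fun i => Num.truncn (F 0%N i%:R)).
Proof.
elim: m F B => [|m IH] F B FG; first exact: growth0_negligible FG.
have mono0 s t : 0 <= s -> s <= t -> F 0%N s <= F 0%N t.
  by move=> s0 st; apply: (growth_mono FG).
apply: (negligible_vdc ip_norm A1 T_le x_le).
- by move=> i j ij; apply: le_truncn; apply: mono0 => //; rewrite ler_nat.
- exact: growth_slow_gaps FG.
move=> h h0; have [|B' FG'] := growth_diff FG (_ : 0 < h%:R); first by rewrite ltr0n.
apply: (negligible_step A1 T_le (IH _ _ FG')).
move=> i /=; rewrite natrD; apply: truncn_sub.
  by case: FG => _ _ F0 _ _; rewrite ltW // F0.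
by apply: mono0 => //; rewrite lerDl.
Qed.

End GrowthNegligible.

(** * From the definitions to the estimates *)

Lemma ereal_sup_bound (R : realType) (S : set (\bar R)) :
  (ereal_sup S < +oo)%E -> exists C : R, forall y, S y -> (y <= C%:E)%E.
Proof.
(* If the supremum is [-oo], [fine] gives the default 0, still a bound. *)
move=> Soo; exists (fine (ereal_sup S)) => y Sy.
have : (y <= ereal_sup S)%E by apply: ereal_sup_ubound.
case: (ereal_sup S) Soo => [r|//|] _ //= => /le_trans; apply.
exact: leNye.
Qed.

Lemma limf_esup_bound (R : realType) (h : R -> \bar R) :
  (limf_esup h +oo%R < +oo)%E ->
  exists C : R, \forall t \near +oo%R, (h t <= C%:E)%E.
Proof.
move=> /ereal_inf_lt[_ [V VF <-]] /ereal_sup_bound[C CP].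
by exists C; apply: filterS VF => t Vt; apply: CP; exists t.
Qed.

(** Translating past the threshold makes the eventual conditions hold on [[0, +oo[]. The translation
    is by an integer, so that sampling at integers gives a tail of the original sequence. *)
Lemma classP_growth (R : realType) m (f : R -> R) : classP m.+1 f ->
  exists (s : nat) (B : R), growth m (fun k t => derive1n k f (s.+1%:R + t)) B.
Proof.
move=> [_ fd /limf_esup_bound[C1 h1] /limf_esup_bound[C2 h2]].
have [t0 [_ tP]] := filterI fd (filterI h1 h2).
have [s sP] := nat_ge t0.
(* The first term comes from [s.+1 + t <= (1 + s.+1) * (1 + t)]; the final 1 ensures positivity. *)
exists s, (`|C1| * (1 + s.+1%:R) + `|C2| + 1).
have st t : 0 <= t -> t0 < s.+1%:R + t.
  move=> t_ge0; apply: le_lt_trans (sP s (leqnn s)) _; rewrite -natr1; lra.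
have pos k t : (k <= m.+1)%N -> 0 <= t -> 0 < derive1n k f (s.+1%:R + t).
  by move=> km t_ge0; have [[_ /(_ k km)[]]] := tP _ (st _ t_ge0).
have S0 : (0 : R) < s.+1%:R by rewrite ltr0n.
have n1 := normr_ge0 C1; have n2 := normr_ge0 C2.
have n3 : 0 <= `|C1| * (1 + s.+1%:R) by rewrite mulr_ge0 // addr_ge0.
split=> //.
- move=> k t km t_ge0.
  have [[/(_ k km) dk _] _] := tP _ (st _ t_ge0).
  have dk' : is_derive (1 * t + s.+1%:R) 1 (derive1n k f)
      (derive1n k.+1 f (1 * t + s.+1%:R)).
    rewrite mul1r addrC derive1nS derive1E; exact: DeriveDef.
  have := is_derive_affine dk'; rewrite !mul1r [t + _]addrC.
  congr is_derive; apply/funext => u.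
  by rewrite mul1r addrC.
- move=> t t_ge0; have [_ [+ _]] := tP _ (st _ t_ge0); rewrite /= lee_fin.
  have u0 : 0 < s.+1%:R + t by rewrite ltr_wpDr.
  have p1 := pos m.+1 t (leqnn _) t_ge0.
  rewrite ler_pdivrMr ?mulr_gt0 // => /le_trans; apply.
  rewrite mulrA ler_pM2r //.
  apply: (@le_trans _ _ (`|C1| * (s.+1%:R + t))).
    by rewrite ler_pM2r // ler_norm.
  apply: (@le_trans _ _ (`|C1| * (1 + s.+1%:R) * (1 + t))).
    rewrite -mulrA; apply: ler_wpM2l => //.
    have : 0 <= s.+1%:R * t by rewrite mulr_ge0.
    lra.
  by apply: ler_wpM2r; lra.
- move=> u t t_ge0 tu; have [_ [_ +]] := tP _ (st _ t_ge0) => /= hsup.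
  have p1 := pos m.+1 t (leqnn _) t_ge0.
  have : ((derive1n m.+1 f (s.+1%:R + u) / derive1n m.+1 f (s.+1%:R + t))%:E
      <= C2%:E)%E.
    apply: le_trans hsup; apply: ereal_sup_ubound; exists (s.+1%:R + u) => //.
    by rewrite /= in_itv /= andbT lerD2l.
  rewrite lee_fin ler_pdivrMr // => /le_trans; apply.
  rewrite ler_pM2r //; have := ler_norm C2; lra.
Qed.

Lemma power_bounded_bound (R : realType) (H : normedModType R[i])
    (T : {linear H -> H}) : power_bounded T ->
  exists2 M : R, 0 <= M & forall n y, nm (iter n T y) <= M * nm y.
Proof.
move=> /ereal_sup_bound[C CP]; exists `|C| => // n y.
have [->|y0] := eqVneq y 0.
  have -> : iter n T (0 : H) = 0 by elim: n => //= n ->; rewrite linear0.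
  by rewrite nm0 mulr0.
have ny : 0 < nm y.
  rewrite lt_neqAle nm_ge0 andbT eq_sym; apply: contra y0 => /eqP h.
  by apply/eqP/nm_eq0.
have [z yz z1] : exists2 z, y = rc (nm y) *: z & nm z = 1.
  exists (rc (nm y)^-1 *: y).
    by rewrite scalerA -rcM mulfV ?gt_eqF // scale1r.
  by rewrite nmZ cm_rc ger0_norm ?mulVf ?gt_eqF // invr_ge0 ltW.
rewrite {1}yz iterlinZ nmZ cm_rc (ger0_norm (ltW ny)) mulrC ler_pM2r //.
have : ((nm (iter n T z))%:E <= C%:E)%E.
  apply: le_trans (CP _ _); last by exists n.
  apply: ereal_sup_ubound; exists z => //=.
  by rewrite nmE z1.
by rewrite lee_fin => /le_trans; apply; apply: ler_norm.
Qed.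

Theorem corollary4p13 (R : realType)
    (H : completeNormedModType R[i]) (ip : {dot H for Num.conj})
    (ip_norm : forall x : H, ip x x = `|x| ^+ 2)
    (T : {linear H -> H}) (T_cont : continuous T)
    (T_pb : power_bounded T)
    (T_spec : point_spectrum T `&` unit_circle R = set0)
    (l : nat) (g : R -> R) (gM : classM l g)
    (m : nat) (m_ge1 : (1 <= m)%N) (f : R -> R) (fP : classP m f) (x : H) :
  (N%:R : R[i])^-1 *: \sum_(1 <= n < N.+1)
     (e2pi (g n%:R) *: oppow T (Num.floor (f n%:R)) x) @[N --> \oo]
  --> (0 : H).
Proof.
have [M M0 TM] := power_bounded_bound T_pb.
pose A := (1 + M) * (1 + nm x).
have x0 := nm_ge0 x.
have MA : M <= A by rewrite /A; nra.
have A1 : 1 <= A by rewrite /A; nra.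
have T_le n y : nm (iter n T y) <= A * nm y.
  by apply: le_trans (TM n y) _; apply: ler_wpM2r => //; apply: nm_ge0.
have x_le n : nm (iter n T x) <= A.
  by apply: le_trans (TM n x) _; rewrite /A; nra.
have spec (z : R[i]) y : cm z = 1 -> T y = z *: y -> y = 0.
  move=> z1 Ty; apply/eqP; apply: contrapT => /negP y0.
  suff : (point_spectrum T `&` unit_circle R) z by rewrite T_spec.
  split; first by exists y.
  by rewrite /unit_circle /= cmE z1.
case: m m_ge1 fP => // m _ /classP_growth[s [B FG]].
have /= Fn := growth_negligible ip_norm A1 T_le x_le spec FG.
(* The sum starts at [n = 1], hence the shift; [Fn] concerns the tail of [a] from [s] on. *)
pose a i := Num.truncn (f i.+1%:R).
have an : negligible T x a.
  apply: (negligible_tail x_le (s := s)).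
  by move: Fn; congr negligible; apply/funext => i; rewrite /a -addSn natrD.
apply/cvgrPdist_lt => e e0.
have e0' : 0 < cre e by rewrite -rc_lt -rc_ge0E // ltW.
have [N0 NP] := an (cre e / 2) (divr_gt0 e0' (ltr0Sn _ _)).
exists N0.+1 => // N /= N0N.
rewrite sub0r normrN nmE (rc_ge0E (ltW e0)) rc_lt.
have NR : (0 : R) < N%:R by rewrite ltr0n; apply: leq_trans N0N.
rewrite nmZ cmV cm_nat ltr_pdivrMl //.
rewrite big_add1 big_mkord /=.
have -> : \sum_(i < N) e2pi (g i.+1%:R) *: oppow T (Num.floor (f i.+1%:R)) x =
    \sum_(i < N) e2pi (g i.+1%:R) *: iter (a i) T x.
  (* [truncn] is 0 on negative reals, in accordance with [oppow] being the identity there. *)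
  by apply: eq_bigr => i _; rewrite /a truncEfloor; case: (Num.floor _).
apply: le_lt_trans (NP N (ltnW N0N) (fun i => e2pi (g i.+1%:R)) _) _.
  by move=> i; rewrite cm_e2pi.
by rewrite ltr_pM2l // ltr_pdivrMr // ltr_pMr // ltr1n.
Qed.
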